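(* Let $E$ be a real Banach space and $D$ a dense subset of $(B_{E^*},w^* )$. Then the following are equivalent: (i) $\operatorname{span}(D)$ is induced by a $1$-projectional skeleton in $E$ and $\operatorname{span}(D)\cap B_{E^*}=D$. (ii) $D$ is a convex symmetric set induced by a retractional skeleton in $(B_{E^*},w^* )$. (iii) $D$ is weak$^*$ countably compact and $(E,\sigma(E,D))$ is monotonically Sokolov.
   Context: Banach spaces are over $\mathbb{R}$; all topological spaces are assumed to be Tychonoff. $B_{E^*}$ is the closed unit ball of $E^*$, $w^*$ the weak$^*$ topology, $\operatorname{span}$ the (algebraic) linear hull. $\sigma(E,D)$ is the weakest topology on $E$ making every functional in $D$ continuous. Projectional skeleton: a projectional skeleton in $E$ is a family $\{P_s\}_{s\in\Gamma}$ of bounded linear projections on $E$, indexed by an up-directed partially ordered set $\Gamma$, such that (1) $P_s[E]$ is separable for each $s\in\Gamma$; (2) $E=\bigcup_{s\in\Gamma}P_s[E]$; (3) if $s\le t$ in $\Gamma$ then $P_s=P_s\circ P_t=P_t\circ P_s$; (4) given $s_0<s_1<\cdots$ in $\Gamma$, $t=\sup_{n\in\omega}s_n$ exists in $\Gamma$ and $P_t[E]=\overline{\bigcup_{n\in\omega}P_{s_n}[E]}$. It is a $1$-projectional skeleton if its members are norm one projections (i.e. $\|P_s\|\le1$ for every $s$; zero projections are allowed). The subspace of $E^*$ induced by $\{P_s\}_{s\in\Gamma}$ is $\bigcup_{s\in\Gamma}P_s^*[E^*]$. Retractional skeleton: a retractional skeleton in a countably compact space $X$ is a family of continuous retractions $\mathfrak{s}=\{r_s\}_{s\in\Gamma}$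 on $X$, indexed by an up-directed partially ordered set $\Gamma$, such that (a) $r_s[X]$ is a metrizable compact space for each $s\in\Gamma$; (b) if $s\le t$ in $\Gamma$ then $r_s=r_s\circ r_t=r_t\circ r_s$; (c) given $s_0<s_1<\cdots$ in $\Gamma$, $t=\sup_{n\in\omega}s_n$ exists in $\Gamma$ and $r_t(x)=\lim_{n\to\infty}r_{s_n}(x)$ for every $x\in X$; (d) for every $x\in X$, $x=\lim_{s\in\Gamma}r_s(x)$. The set induced by $\mathfrak{s}$ in $X$ is $\bigcup_{s\in\Gamma}r_s[X]$. Monotonically Sokolov: a space $T$ is monotonically Sokolov if one can assign to every countable family $\mathcal{F}$ of closed subsets of $T$ a continuous retraction $r_{\mathcal{F}}:T\to T$ (i.e. $r_{\mathcal{F}}\circ r_{\mathcal{F}}=r_{\mathcal{F}}$) and a countable external network $\mathcal{N}(\mathcal{F})$ of $r_{\mathcal{F}}(T)$ in $T$ such that $r_{\mathcal{F}}(F)\subset F$ for every $F\in\mathcal{F}$ and the assignment $\mathcal{N}$ is $\omega$-monotone. Here a family $\mathcal{N}$ of subsets of $T$ is an external network of $A\subset T$ in $T$ if for every $a\in A$ and every open $U\ni a$ there is $N\in\mathcal{N}$ with $a\in N\subset U$; and $\omega$-monotone means that $\mathcal{F}\subset\mathcal{G}$ implies $\mathcal{N}(\mathcal{F})\subset\mathcal{N}(\mathcal{G})$, and $\mathcal{N}(\bigcup_{n\in\omega}\mathcal{F}_n)=\bigcup_{n\in\omega}\mathcal{N}(\mathcal{F}_n)$ for every increasing sequence $(\mathcal{F}_n)_{n\in\omega}$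 of countable families of closed subsets of $T$ (and all values of $\mathcal{N}$ are countable). *)

(* Defs.v *)
From HB Require Import structures.
From mathcomp Require Import all_boot all_order all_algebra.
From mathcomp Require Import all_classical all_reals all_analysis.
Import Order.TTheory GRing.Theory Num.Theory numFieldNormedType.Exports.

Set Implicit Arguments.
Unset Strict Implicit.
Unset Printing Implicit Defensive.

Local Open Scope classical_set_scope.
Local Open Scope ring_scope.

Section ContinuousLinear.
Context {R : realType} (E F : normedModType R).

Definition clin_pred : {pred E -> F} := [pred f | `[< linear f /\ continuous f >]].

Record clin := Clin { clin_fun :> E -> F ; clin_subproof : clin_fun \in clin_pred }.

HB.instance Definition _ := [isSub for clin_fun].
HB.instance Definition _ := [Choice of clin by <:].

Lemma clin_submod_closed : submod_closed clin_pred.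
Proof.
split=> [|a f g /asboolP[lf cf] /asboolP[lg cg]]; apply/asboolP; split.
- by move=> b x y; rewrite /= scaler0 addr0.
- exact: cst_continuous.
- move=> b x y; change (a *: f (b *: x + y) + g (b *: x + y) =
    b *: (a *: f x + g x) + (a *: f y + g y)).
  by rewrite lf lg !scalerDr !scalerA [b * a]mulrC !addrA [_ + b *: g x]addrAC.
- move=> x; apply: (@cvgD _ _ _ _ _ (a \*: f) g); last exact: cg.
  by apply: cvgZ; [exact: cvg_cst|exact: cf].
Qed.

HB.instance Definition _ :=
  GRing.isSubmodClosed.Build R (E -> F) clin_pred clin_submod_closed.
HB.instance Definition _ := [SubChoice_isSubLmodule of clin by <:].

Lemma clin_linear (f : clin) : linear f.
Proof. by case: f => f /= /asboolP[]. Qed.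

HB.instance Definition _ (f : clin) :=
  GRing.isLinear.Build R E F *:%R (clin_fun f) (clin_linear f).

Lemma clin_continuous (f : clin) : continuous f.
Proof. by case: f => f /= /asboolP[]. Qed.

(* The set below is bounded above because [f] is continuous. *)
Definition opnorm (f : clin) : R := sup [set `|f x| | x in [set x : E | `|x| <= 1]].

End ContinuousLinear.

Arguments clin_pred {R} E F.

Lemma clin_comp_subproof {R : realType} {E F G : normedModType R}
    (g : clin F G) (f : clin E F) : g \o f \in clin_pred E G.
Proof.
apply/asboolP; split; first by move=> a x y; rewrite /= !linearP.
by move=> x; apply: continuous_comp; exact: clin_continuous.
Qed.

Definition clin_comp {R : realType} {E F G : normedModType R}
  (g : clin F G) (f : clin E F) : clin E G := Clin (clin_comp_subproof g f).

Section Topology.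

(* The weakest topology on [S] making every [f i] continuous. *)
Definition initial_family {I : Type} {S : choiceType} {T : topologicalType}
    (f : I -> S -> T) : topologicalType :=
  sup_topology (fun i => Topological.class (initial_topology (f i))).

Definition countably_compact {T : topologicalType} (A : set T) :=
  forall f : nat -> set T, (forall n, open (f n)) ->
    A `<=` \bigcup_n f n -> finite_subset_cover [set: nat] f A.

Definition separable_set {T : topologicalType} (A : set T) :=
  exists C : set T, [/\ countable C, C `<=` A & A `<=` closure C].

(* [m] is a full metric structure on the carrier of [T]; only its topology has to
   agree with the given one. *)
Definition metrizable (R : realType) (T : topologicalType) :=
  exists m : Metric R T, @open (Metric.Pack m) = (@open T : set_system T).

End Topology.

Section Directed.
Local Open Scope order_scope.
Context {d : Order.disp_t} (G : porderType d).

Definition up_directed := [set: G] !=set0 /\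
  forall s t : G, exists u, s <= u /\ t <= u.

Definition tail_filter : set_system G :=
  filter_from [set: G] (fun s => [set t | s <= t]).

End Directed.

Arguments tail_filter {d} G.

Section LinearHull.
Context {R : realType} {V : lmodType R}.

Definition lin_span (A : set V) : set V :=
  [set v | exists n (c : 'I_n -> R) (a : 'I_n -> V),
     (forall i, A (a i)) /\ v = \sum_(i < n) c i *: a i].

Definition symmetric_set (A : set V) := forall v, A v -> A (- v).

End LinearHull.

Section Dual.
Context {R : realType}.

Definition dual (E : normedModType R) : lmodType R := clin E R^o.

Definition dual_ball (E : normedModType R) : set (dual E) :=
  [set f | opnorm f <= 1].
Arguments dual_ball : clear implicits.

Definition adjoint {E F : normedModType R} (P : clin E F) (f : dual F) : dual E :=
  clin_comp f P.

Definition wstar (E : normedModType R) : topologicalType :=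
  initial_family (fun (x : E) (f : dual E) => f x : R^o).

Definition wstar_ball (E : normedModType R) : topologicalType :=
  set_type (dual_ball E : set (wstar E)).

Definition ball_trace {E : normedModType R} (D : set (dual E)) :
  set (wstar_ball E) := [set f | D (set_val f)].

Definition sigma (E : normedModType R) (D : set (dual E)) : topologicalType :=
  initial_family (fun (f : set_type D) (x : E) => set_val f x : R^o).

End Dual.

Arguments dual_ball {R} E.

Section ProjectionalSkeleton.
Context {R : realType} {E : normedModType R}.

Record projectional_skeleton {d : Order.disp_t} {G : porderType d}
    (P : G -> clin E E) : Prop := {
  pskel_directed : up_directed G ;
  pskel_proj : forall s, P s \o P s = P s :> (E -> E) ;
  pskel_separable : forall s, separable_set (range (P s)) ;
  pskel_cover : \bigcup_s range (P s) = [set: E] ;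
  pskel_comp : forall s t, (s <= t)%O ->
    P s \o P t = P s :> (E -> E) /\ P t \o P s = P s :> (E -> E) ;
  pskel_sup : forall s : nat -> G, (forall n, (s n < s n.+1)%O) ->
    exists t, isLub (range s) t /\
      range (P t) = closure (\bigcup_n range (P (s n)))
}.

Definition one_projectional_skeleton {d : Order.disp_t} {G : porderType d}
    (P : G -> clin E E) :=
  projectional_skeleton P /\ forall s, opnorm (P s) <= 1.

Definition induced_by_one_projectional_skeleton (S : set (dual E)) :=
  exists (d : Order.disp_t) (G : porderType d) (P : G -> clin E E),
    one_projectional_skeleton P /\ S = \bigcup_s range (adjoint (P s)).

End ProjectionalSkeleton.

Section RetractionalSkeleton.
Context (R : realType) {X : topologicalType}.

Definition continuous_retraction (r : X -> X) := continuous r /\ r \o r = r.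

Record retractional_skeleton {d : Order.disp_t} {G : porderType d}
    (r : G -> X -> X) : Prop := {
  rskel_countably_compact : countably_compact [set: X] ;
  rskel_directed : up_directed G ;
  rskel_retraction : forall s, continuous_retraction (r s) ;
  rskel_compact : forall s, compact (range (r s)) ;
  rskel_metrizable : forall s, metrizable R (set_type (range (r s))) ;
  rskel_comp : forall s t, (s <= t)%O -> r s \o r t = r s /\ r t \o r s = r s ;
  rskel_sup : forall s : nat -> G, (forall n, (s n < s n.+1)%O) ->
    exists t, isLub (range s) t /\
      forall x, r (s n) x @[n --> \oo] --> r t x ;
  rskel_lim : forall x, r s x @[s --> tail_filter G] --> x
}.

Definition induced_by_retractional_skeleton (D : set X) :=
  exists (d : Order.disp_t) (G : porderType d) (r : G -> X -> X),
    retractional_skeleton r /\ D = \bigcup_s range (r s).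

End RetractionalSkeleton.

Section MonotonicallySokolov.
Context (T : topologicalType).

Definition external_network (N : set (set T)) (A : set T) :=
  forall a U, A a -> open U -> U a -> exists M, [/\ N M, M a & M `<=` U].

Definition countable_closed_family (F : set (set T)) :=
  countable F /\ F `<=` closed.

(* Families are sets of subsets of [T]; countable includes finite and empty.
   [r] and [N] are only constrained on countable families of closed sets. *)
Definition monotonically_Sokolov :=
  exists (r : set (set T) -> T -> T) (N : set (set T) -> set (set T)),
    [/\ forall F, countable_closed_family F ->
          [/\ continuous_retraction (r F), countable (N F),
              external_network (N F) (range (r F)) &
              forall A, F A -> r F @` A `<=` A],
        forall F G, countable_closed_family F -> countable_closed_family G ->
          F `<=` G -> N F `<=` N G &
        forall F : nat -> set (set T),
          (forall n, countable_closed_family (F n)) ->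
          (forall n, F n `<=` F n.+1) ->
          N (\bigcup_n F n) = \bigcup_n N (F n)].

End MonotonicallySokolov.

(* Main.v *)
Require Import Defs.
From HB Require Import structures.
From mathcomp Require Import all_boot all_order all_algebra finmap.
From mathcomp Require Import all_classical all_reals all_analysis.
From mathcomp Require Import lra ring.
Import Order.TTheory GRing.Theory Num.Theory numFieldNormedType.Exports.

(** Both nontrivial implications build norm one projections out of pairs of
    countable sets, [A] in [E] and [B] in [D], such that [B] norms the closure
    of [A] and every [x] in [E] agrees on [B] with some vector of that closure,
    necessarily unique. The map sending [x] to this vector is a projection [P],
    and its adjoint carries the dual ball onto the weak* closure of [B]. Such
    pairs are found by closing off: a rule tells which new vectors and
    functionals a finite list of old ones calls for, and the sets closed under
    the rule are cofinal among countable sets and stable under increasing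
    unions. They play the part of countable elementary submodels. The hull of a
    set under a rule moreover depends on the set in an [omega]-monotone way
    ([hull_bigcup]).

    A dense, countably compact [D] meets every weak* closed condition bearing
    on countably many vectors: each functional of the dual ball coincides with
    an element of [D] on any given countable set, and this element can be taken
    in the closure of [B] when [B] approximates the functional
    ([countably_compact_interpolation]).

    From projections to retractions, the adjoints of the members of a
    projectional skeleton restrict to retractions of the dual ball, compact by
    the Banach-Alaoglu theorem, with metrizable ranges because the ranges of
    the projections are separable ([retractional_of_projectional]).

    From retractions to the Sokolov property, a retraction [r_t] is shown to be
    the adjoint of a projection when [t] is the supremum of the indices of a
    closed set. A vector of [E] is invariant under [r_s] for all large [s]
    ([skel_factor]), and each [r_s] is determined by countably many vectors
    ([skel_separating]); so [A] can be made invariant under [r_t] while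
    separating the points of [r_t B]. As [r_t B] is the closure of a rationally
    convex symmetric subset of [D], it is convex and symmetric, and a
    Hahn-Banach argument shows that on it each [x] is a uniform limit of
    elements of [A] ([range_approximation]). By completeness of [E] this limit
    comes from a vector [P x] ([range_lift]). To make [P] preserve a closed set
    [C], the rule reflects in [B] every finite system of conditions on elements
    of [D] that fails on [C]. The balls centred at [A] with radii [1 / (n + 1)]
    are then the required network.

    From the Sokolov property to projections, the family of rational
    half-spaces given by [B] yields a retraction preserving the values of [B].
    When [A] meets the nonempty members of the network of its range, that range
    lies in the [sigma(E, D)]-closure of [A], which is the norm closure because
    [D] contains the functionals separating points from separable subspaces
    ([sigma_closure_sub]). The projections obtained form a skeleton indexed by
    the countable closed sets ([projectional_of_rule]). *)

Set Implicit Arguments.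
Unset Strict Implicit.
Unset Printing Implicit Defensive.

Local Open Scope classical_set_scope.
Local Open Scope ring_scope.

(** * Sublinear functionals and the Mazur-Orlicz theorem *)

Section MazurOrlicz.
Context {R : realType} {V : lmodType R}.
Implicit Types (p q N : V -> R) (C : set (V * R)).

Definition sublinear p :=
  (forall x y, p (x + y) <= p x + p y) /\
  (forall c x, 0 <= c -> p (c *: x) = c * p x).

Definition cone C := [/\ C (0, 0),
  forall u v, C u -> C v -> C (u.1 + v.1, u.2 + v.2) &
  forall c u, 0 <= c -> C u -> C (c *: u.1, c * u.2)].

Lemma sublinear0 p : sublinear p -> p 0 = 0.
Proof. by case=> _ /(_ 0 0 (lexx _)); rewrite scaler0 mul0r. Qed.

Lemma sublinear_geN p x : sublinear p -> - p (- x) <= p x.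
Proof.
move=> ps; have := ps.1 x (- x); rewrite subrr sublinear0 //; lra.
Qed.

(** The infimal convolution of [N] with the cone; the positivity assumption is
    what bounds it below. *)
Lemma sublinear_cone N C : sublinear N -> cone C ->
  (forall u, C u -> 0 <= N (- u.1) + u.2) ->
  exists p, [/\ sublinear p, forall x, p x <= N x &
                forall u, C u -> p u.1 <= u.2].
Proof.
move=> Ns [C0 CD CZ] NC.
pose S x := [set N (x - u.1) + u.2 | u in C].
have lbS x : has_lbound (S x).
  exists (- N (- x)) => _ [u Cu <-].
  have := Ns.1 (x - u.1) (- x); rewrite addrAC subrr add0r.
  have := NC _ Cu; lra.
have Sx0 x : S x !=set0 by exists (N (x - 0) + 0); exists (0, 0).
have infS x : has_inf (S x) by split.
pose p x := inf (S x).
have ple x u : C u -> p x <= N (x - u.1) + u.2.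
  by move=> Cu; apply: ge_inf => //; exists u.
exists p; split; first split.
- move=> x y; apply/ler_addgt0Pr => e e0.
  have e2 : 0 < e / 2 by rewrite divr_gt0.
  have [_ [u Cu <-] pu] := inf_adherent e2 (infS x).
  have [_ [v Cv <-] pv] := inf_adherent e2 (infS y).
  have := ple (x + y) _ (CD _ _ Cu Cv) => /=.
  have := Ns.1 (x - u.1) (y - v.1); rewrite opprD addrACA.
  move: pu pv; rewrite -/(p x) -/(p y); lra.
- have pZ c x : 0 <= c -> p (c *: x) <= c * p x.
    rewrite le_eqVlt => /predU1P[<-|c0].
      by have := ple (0 *: x) _ C0; rewrite /= scale0r subr0 (sublinear0 Ns) mul0r addr0.
    rewrite -ler_pdivrMl//; apply: lb_le_inf => // _ [u Cu <-].
    rewrite ler_pdivrMl// mulrDr -Ns.2 ?(ltW c0)// scalerBr.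
    exact: (ple _ (_, _) (CZ _ _ (ltW c0) Cu)).
  move=> c x c0; apply/eqP; rewrite eq_le pZ //=.
  have [->|cn0] := eqVneq c 0.
    rewrite mul0r scale0r; apply: lb_le_inf => // _ [u Cu <-].
    by rewrite sub0r NC.
  have cp : 0 < c by rewrite lt0r cn0.
  by rewrite -ler_pdivlMl// -{1}[x](scalerK cn0) pZ// invr_ge0.
- by move=> x; have := ple x _ C0; rewrite /= subr0 addr0.
- by move=> u Cu; have := ple u.1 _ Cu; rewrite subrr sublinear0// add0r.
Qed.

(** Zorn's lemma applies since a chain of sublinear functionals below [N] is
    bounded below at [x] by [- N (- x)], and its pointwise infimum is again
    sublinear. *)
Lemma minimal_sublinear N : sublinear N ->
  exists p, [/\ sublinear p, forall x, p x <= N x &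
    forall q, sublinear q -> (forall x, q x <= p x) -> q = p].
Proof.
move=> Ns.
pose T := {p : V -> R | sublinear p /\ forall x, p x <= N x}.
pose le (p q : T) := `[< forall x, sval q x <= sval p x >].
have [|||A totA|p pmax] := @Zorn T le.
- by move=> p; apply/asboolP.
- move=> p q r /asboolP pq /asboolP qr; apply/asboolP => x.
  exact: le_trans (qr x) (pq x).
- move=> [p pP] [q qP] /asboolP /= pq /asboolP /= qp; apply: eq_exist.
  by apply/funext => x; apply/eqP; rewrite eq_le pq qp.
- have [->|/set0P[p0 Ap0]] := eqVneq A set0.
    by exists (exist _ N (conj Ns (fun=> lexx _))).
  pose S x := [set sval p x | p in A].
  have lbS x : has_lbound (S x).
    exists (- N (- x)) => _ [[q [qs qN]] Aq <-] /=.
    by apply: le_trans (sublinear_geN x qs); rewrite lerN2.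
  have Sx0 x : S x !=set0 by exists (sval p0 x); exists p0.
  pose g x := inf (S x).
  have gle x (p : T) : A p -> g x <= sval p x by move=> Ap; apply: ge_inf => //; exists p.
  have gs : sublinear g.
    split=> [x y|c x c0].
      apply/ler_addgt0Pr => e e0; have e2 : 0 < e / 2 by rewrite divr_gt0.
      have [_ [u Au <-] pu] := inf_adherent e2 (conj (Sx0 x) (lbS x)).
      have [_ [v Av <-] pv] := inf_adherent e2 (conj (Sx0 y) (lbS y)).
      have [w [Aw wu wv]] : exists w, [/\ A w, sval w x <= sval u x & sval w y <= sval v y].
        by have [/asboolP uv|/asboolP vu] := totA _ _ Au Av; [exists v|exists u]; split.
      have := gle (x + y) _ Aw; have := (svalP w).1.1 x y.
      move: pu pv; rewrite -/(g x) -/(g y); lra.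
    have ZS (p : T) : sval p (c *: x) = c * sval p x by have [[_ ->]] := svalP p.
    apply/eqP; rewrite eq_le; apply/andP; split.
      have [c_0|cn0] := eqVneq c 0.
        by have := gle (c *: x) _ Ap0; rewrite ZS c_0 !mul0r.
      have cp : 0 < c by rewrite lt0r cn0.
      rewrite -ler_pdivrMl//; apply: lb_le_inf => // _ [u Au <-].
      by rewrite ler_pdivrMl// -ZS gle.
    apply: lb_le_inf => // _ [u Au <-].
    by rewrite ZS ler_wpM2l// gle.
  have gN x : g x <= N x by apply: (le_trans (gle _ _ Ap0)); exact: (svalP p0).2.
  exists (exist _ g (conj gs gN)) => s As; apply/asboolP => x; exact: gle.
- have [ps pN] := svalP p; exists (sval p); split=> // q qs qp.
  have qN x : q x <= N x := le_trans (qp x) (pN x).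
  have := pmax (exist _ q (conj qs qN)) => <- //; exact/asboolP.
Qed.

(** A minimal sublinear functional is additive, hence linear; the cone
    conditions are absorbed into the sublinear functional beforehand. *)
Lemma mazur_orlicz N C : sublinear N -> cone C ->
  (forall u, C u -> 0 <= N (- u.1) + u.2) ->
  exists f : V -> R, [/\ forall a x y, f (a *: x + y) = a * f x + f y,
    forall x, f x <= N x & forall u, C u -> f u.1 <= u.2].
Proof.
move=> Ns Cc NC; have [p0 [p0s p0N p0C]] := sublinear_cone Ns Cc NC.
have [p [ps pp0 pmin]] := minimal_sublinear p0s.
(* By minimality, convolving [p] with the ray through [(- x, - p x)] leaves it
   unchanged. *)
have padd x y : p y + p x <= p (y + x).
  pose C' : set (V * R) := [set (- (c *: x), - (c * p x)) | c in [set c | 0 <= c]].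
  have [|u|q [qs qp qC]] := @sublinear_cone p C' ps.
  - split.
    + by exists 0 => //=; rewrite scale0r mul0r !oppr0.
    + move=> _ _ [c /= c0 <-] [d /= d0 <-]; exists (c + d) => /=; first exact: addr_ge0.
      by rewrite scalerDl mulrDl !opprD.
    + move=> c _ c0 [d /= d0 <-]; exists (c * d) => /=; first exact: mulr_ge0.
      by rewrite scalerN scalerA mulrN mulrA.
  - by move=> [c /= c0 <-] /=; rewrite opprK ps.2// subrr.
  have qE := pmin q qs qp.
  have Cx : C' (- x, - p x) by exists 1 => //=; rewrite scale1r mul1r.
  have := qC _ Cx; rewrite qE /= => pNx.
  by have := ps.1 (y + x) (- x); rewrite addrK; move: pNx; lra.
have pD x y : p (x + y) = p x + p y by apply/eqP; rewrite eq_le ps.1 padd.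
have pN x : p (- x) = - p x.
  by have := pD x (- x); rewrite subrr sublinear0//; lra.
exists p; split=> [a x y|x|u Cu]; last 2 first.
- exact: le_trans (pp0 x) (p0N x).
- exact: le_trans (pp0 _) (p0C _ Cu).
rewrite pD; congr (_ + _); have [a0|a0] := leP 0 a; first exact: ps.2.
have na : 0 <= - a by rewrite oppr_ge0 ltW.
by rewrite -[a]opprK scaleNr pN ps.2 ?opprK// mulNr opprK.
Qed.

End MazurOrlicz.

(** * Compactness, countable compactness and weak topologies *)

Lemma le_add_natSinv {R : realType} (x y : R) :
  (forall n : nat, x <= y + n.+1%:R^-1) -> x <= y.
Proof.
move=> xy; apply/ler_addgt0Pr => e e0.
have [n _ nP] : \forall n \near \oo, n.+1%:R^-1 < e by exact: near_infty_natSinv_lt (PosNum e0).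
by apply: le_trans (xy n) _; rewrite lerD2l ltW// nP/=.
Qed.

Lemma nonincreasing_chain {T : Type} (Z : nat -> set T) :
  (forall n, Z n.+1 `<=` Z n) -> forall m n, (m <= n)%N -> Z n `<=` Z m.
Proof.
move=> decZ m; elim=> [|n IH]; first by rewrite leqn0 => /eqP->.
by rewrite leq_eqVlt => /predU1P[->//|/IH nm x /decZ /nm].
Qed.

Section Compactness.
Context {T : topologicalType}.

Lemma compact_fip {I : choiceType} (K : set T) (Z : I -> set T) :
  compact K -> (forall i, closed (Z i)) ->
  (forall s : seq I, exists x, K x /\ forall i, i \in s -> Z i x) ->
  exists x, K x /\ forall i, Z i x.
Proof.
move=> cK cZ KZ.
pose B (s : seq I) := [set x | K x /\ forall i, i \in s -> Z i x].
have FF : ProperFilter (filter_from [set: seq I] B).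
  apply: filter_from_proper => [|s _]; last first.
    by have [x Bx] := KZ s; exists x.
  apply: filter_from_filter; first by exists [::].
  move=> s t _ _; exists (s ++ t) => // x [Kx Zx]; split; split => // i si;
    by apply: Zx; rewrite mem_cat si ?orbT.
have [|x [Kx Fx]] := cK _ FF; first by exists [::] => // x [].
exists x; split=> // i; apply: cZ => U Ux.
by apply: Fx => //; exists [:: i] => // y [_]; apply; rewrite inE.
Qed.

Lemma compact_decreasing (K : set T) (Z : nat -> set T) :
  compact K -> (forall n, closed (Z n)) -> (forall n, Z n.+1 `<=` Z n) ->
  (forall n, exists x, K x /\ Z n x) -> exists x, K x /\ forall n, Z n x.
Proof.
move=> cK cZ decZ KZ; apply: compact_fip => // s.
have Zle := nonincreasing_chain decZ.
have [x [Kx Zx]] := KZ (\max_(i <- s) i)%N; exists x; split=> // i si.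
by apply: Zle Zx; exact: (leq_bigmax_seq (F := id)).
Qed.

Lemma compact_seq_cluster (p : nat -> T) : compact [set: T] ->
  exists q, forall (C : set T) N, closed C -> (forall n, (N <= n)%N -> C (p n)) -> C q.
Proof.
move=> cT.
have [||n|q [_ qP]] := @compact_decreasing _ (fun N => closure [set p n | n in [set n | (N <= n)%N]]) cT.
- by move=> n; exact: closed_closure.
- by move=> n; apply: closure_subset => _ [m /= nm <-]; exists m => //; exact: ltnW.
- by exists (p n); split=> //; apply: subset_closure; exists n => /=.
- exists q => C N cC pC; rewrite (closure_id C).1//.
  by apply: closure_subset (qP N) => _ [n /= /pC Cn <-].
Qed.

Lemma countably_compact_decreasing (A : set T) (Z : nat -> set T) :
  countably_compact A -> (forall n, closed (Z n)) -> (forall n, Z n.+1 `<=` Z n) ->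
  (forall n, exists x, A x /\ Z n x) -> exists x, A x /\ forall n, Z n x.
Proof.
move=> cA cZ decZ AZ; apply: contrapT => /forallNP noZ.
have Zle := nonincreasing_chain decZ.
have [||s _ sP] := cA (fun n => ~` Z n).
- by move=> n; exact: closed_openC.
- by move=> x Ax; have /not_andP[//|/existsNP[n nZ]] := noZ x; exists n.
have [x [Ax Zx]] := AZ (\max_(i <- enum_fset s) i)%N.
by have [i /= si []] := sP x Ax; apply: Zle Zx; exact: (leq_bigmax_seq (F := id)).
Qed.

Lemma closed_le_continuous {R : realType} (g h : T -> R^o) :
  continuous g -> continuous h -> closed [set t | g t <= h t].
Proof.
move=> cg ch; have -> : [set t | g t <= h t] = (fun t => g t - h t) @^-1` [set x | x <= 0].
  by apply/seteqP; split=> t /=; rewrite subr_le0.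
apply: preimage_closed; last exact: closed_le.
by move=> t _; apply: cvgB; [exact: cg|exact: ch].
Qed.

Lemma closed_eq_continuous {R : realType} (g h : T -> R^o) :
  continuous g -> continuous h -> closed [set t | g t = h t].
Proof.
move=> cg ch.
have -> : [set t | g t = h t] = [set t | g t <= h t] `&` [set t | h t <= g t].
  by apply/seteqP; split=> t /= => [->|[gh hg]]; [|apply/eqP; rewrite eq_le gh hg].
by apply: closedI; exact: closed_le_continuous.
Qed.

Lemma continuous_abs {R : realType} (g : T -> R^o) :
  continuous g -> continuous (fun t => `|g t| : R^o).
Proof. by move=> cg t; apply: cvg_norm; exact: cg. Qed.

Lemma continuous_sub {R : realType} (g h : T -> R^o) :
  continuous g -> continuous h -> continuous (fun t => g t - h t : R^o).
Proof. by move=> cg ch t; apply: cvgB; [exact: cg|exact: ch]. Qed.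

End Compactness.

Lemma compact_countably_compact {T : topologicalType} (K : set T) :
  compact K -> countably_compact K.
Proof.
move=> cK f fo Kf; apply: contrapT => nfin.
have [||n|x [Kx xP]] := @compact_decreasing _ K
    (fun n => [set x | forall i, (i <= n)%N -> ~ f i x]) cK.
- move=> n; have -> : [set x | forall i, (i <= n)%N -> ~ f i x] =
      \bigcap_(i in [set i | (i <= n)%N]) ~` f i by [].
  by apply: closed_bigI => i _; exact: open_closedC.
- by move=> n x nx i ni; apply: nx; exact: leqW.
- apply: contrapT => /forallNP nx; apply: nfin.
  exists [fset i | i in iota 0 n.+1]%fset => [i _|x Kx]; first by rewrite inE.
  have /not_andP[//|/existsNP[i /not_implyP[ni /contrapT fi]]] := nx x.
  by have ii : i \in iota 0 n.+1 by [rewrite mem_iota]; exists i => //; apply/imfsetP; exists i.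
- by have [n _ fn] := Kf x Kx; exact: (xP n n).
Qed.

(** The initial topology for the family [f], described by its basic
    neighbourhoods so that it also applies to subspaces. *)
Definition weak_topology {R : realType} {T : topologicalType} {I : choiceType}
    (f : I -> T -> R) :=
  (forall i, continuous (f i : T -> R^o)) /\
  forall x U, nbhs x U -> exists (s : seq I) (e : R), 0 < e /\
    forall y, (forall i, i \in s -> `|f i y - f i x| < e) -> U y.

Section WeakTopology.
Context {R : realType} {T : topologicalType} {I : choiceType} (f : I -> T -> R).

Lemma weak_topology_cvg (F : set_system T) (x : T) : weak_topology f -> Filter F ->
  (forall i, (f i t : R^o) @[t --> F] --> (f i x : R^o)) -> F --> x.
Proof.
move=> [_ wf] FF Fx U /wf[s [e [e0 sU]]]; apply: filterS sU _.
elim: s => [|i s IH]; first by apply: filterE => y i; rewrite in_nil.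
have /cvgrPdist_lt/(_ _ e0) Fi := Fx i; near=> y => j; rewrite inE => /predU1P[->|sj].
  by rewrite distrC; near: y.
by have : forall i, i \in s -> `|f i y - f i x| < e; [near: y|apply].
Unshelve. all: by end_near. Qed.

Lemma weak_topology_continuous (S : topologicalType) (g : S -> T) : weak_topology f ->
  (forall i, continuous (fun s => f i (g s) : R^o)) -> continuous g.
Proof. by move=> wf cg s; apply: weak_topology_cvg => // i; exact: cg. Qed.

Lemma weak_topology_nbhs (x : T) (s : seq I) (e : R) : 0 < e -> weak_topology f ->
  nbhs x [set y | forall i, i \in s -> `|f i y - f i x| < e].
Proof.
move=> e0 [cf _]; elim: s => [|i s IH]; first by apply: filterE => y i; rewrite in_nil.
have /cvgrPdist_lt/(_ _ e0) fi := cf i x.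
near=> y => j; rewrite inE => /predU1P[->|js]; first by rewrite distrC; near: y.
by have : forall i, i \in s -> `|f i y - f i x| < e; [near: y|apply].
Unshelve. all: by end_near. Qed.

End WeakTopology.

Lemma initial_family_weak {R : realType} {I S : choiceType} (f : I -> S -> R^o) :
  @weak_topology R (initial_family f) I f.
Proof.
split=> [i|x U xU].
  move=> x; have /cvg_sup/(_ i) : nbhs (x : initial_family f) --> (x : initial_family f) by [].
  by move=> h V /(@initial_continuous S R^o (f i)) /h.
pose F : set_system (initial_family f) := [set V | exists (s : seq I) (e : R), 0 < e /\
    forall y, (forall i, i \in s -> `|f i y - f i x| < e) -> V y].
have FF : Filter F.
  split.
  - by exists [::], 1.
  - move=> A B [s [e [e0 sA]]] [t [d [d0 tB]]]; exists (s ++ t), (Num.min e d).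
    split=> [|y sty]; first by rewrite lt_min e0.
    split; [apply: sA|apply: tB] => i si;
      by have := sty i; rewrite mem_cat si ?orbT lt_min => /(_ isT)/andP[].
  - by move=> A B AB [s [e [e0 sA]]]; exists s, e; split=> // y /sA /AB.
have : F --> (x : initial_family f).
  apply/cvg_sup => i V; rewrite (@nbhsE (Topological.Pack _)).
  move=> [_ [[W oW <-] Wx] WV]; have /nbhs_ballP[e /= e0 eW] : nbhs (f i x) W by exact: open_nbhs_nbhs.
  exists [:: i], e; split=> // y /(_ i); rewrite inE eqxx => /(_ isT) ye.
  by apply: WV; apply: eW; rewrite /ball /= distrC.
by move=> /(_ _ xU).
Qed.

(** * The dual ball: Hahn-Banach separation and the weak* topology *)

Section OperatorNorm.
Context {R : realType} {E F : normedModType R}.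

Lemma ler_opnorm (f : clin E F) x : `|f x| <= opnorm f * `|x|.
Proof.
have ubS : has_ubound [set `|f x| | x in [set x : E | `|x| <= 1]].
  have /linear_boundedP/pinfty_ex_gt0[M M0 fM] :=
    @continuous_linear_bounded R E F 0 f (@clin_continuous _ _ _ f 0).
  exists M => _ [y /= y1 <-]; apply: le_trans (fM y) _.
  by rewrite ger_pMr.
have [->|x0] := eqVneq x 0; first by rewrite linear0 !normr0 mulr0.
rewrite -ler_pdivrMr ?normr_gt0//; apply: ub_le_sup => //.
exists (`|x|^-1 *: x) => /=.
  by rewrite normrZ ger0_norm ?invr_ge0// mulVf ?normr_eq0.
by rewrite linearZ normrZ ger0_norm ?invr_ge0// mulrC.
Qed.

Lemma opnorm_ge0 (f : clin E F) : 0 <= opnorm f.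
Proof.
rewrite leNgt; apply/negP => f0; have [[x x0]|/forallNP E0] := pselect (exists x : E, x != 0).
  have := ler_opnorm f x; rewrite leNgt => /negP; apply.
  by apply: lt_le_trans (normr_ge0 _); rewrite pmulr_llt0 ?normr_gt0.
move: f0; have -> : opnorm f = sup [set 0]; last by rewrite sup1 ltxx.
congr (sup _); apply/seteqP; split=> [_ [x _ <-]|_ /= ->].
  by have /negP/negPn/eqP-> := E0 x; rewrite linear0 normr0.
by exists 0 => /=; rewrite ?linear0 normr0.
Qed.

Lemma opnorm_le1P (f : clin E F) : opnorm f <= 1 <-> forall x, `|f x| <= `|x|.
Proof.
split=> [f1 x|f1].
  by apply: le_trans (ler_opnorm f x) _; rewrite ler_piMl.
by apply: ge_sup => [|_ [x /= x1 <-]]; [exists `|f 0|, 0 => //=; rewrite normr0|exact: le_trans (f1 x) x1].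
Qed.

Lemma contraction_clin (f : E -> F) : linear f -> (forall x, `|f x| <= `|x|) ->
  exists2 g : clin E F, g = f :> (E -> F) & opnorm g <= 1.
Proof.
move=> lf fb.
pose lf' := GRing.isLinear.Build R E F *:%R f lf.
pose f' : {linear E -> F} := HB.pack f lf'.
have cf : f \in clin_pred E F.
  apply/asboolP; split=> //; apply: (@bounded_linear_continuous R E F f').
  by apply/linear_boundedP; near=> r => x; apply: le_trans (fb x) _; rewrite ler_peMl.
by exists (Clin cf) => //; apply/opnorm_le1P.
Unshelve. all: by end_near. Qed.

End OperatorNorm.

Section HahnBanach.
Context {R : realType} {E : normedModType R}.

Lemma dual_ballP (f : dual E) : dual_ball E f <-> forall x, `|f x| <= `|x|.
Proof. exact: opnorm_le1P. Qed.

Lemma norm_sublinear : sublinear (fun x : E => `|x|).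
Proof. by split=> [x y|c x c0]; [exact: ler_normD|rewrite normrZ ger0_norm]. Qed.

Lemma norm_dominated (f : E -> R) : (forall a x y, f (a *: x + y) = a * f x + f y) ->
  (forall x, f x <= `|x|) -> exists2 g : dual E, g = f :> (E -> R) & dual_ball E g.
Proof.
move=> lf fle; apply: contraction_clin => [a x y|x]; first exact: lf.
have f0 : f 0 = 0 by have := lf 1 0 0; rewrite scale1r addr0 mul1r; lra.
rewrite /Num.Def.normr /=; apply/ler_normlP; split; last exact: fle.
by have := fle (- x); rewrite -[- x]scaleN1r -[_ *: _]addr0 lf f0 mulN1r addr0 scaleN1r addr0 normrN.
Qed.

Definition linear_subspace (M : set E) :=
  M 0 /\ forall (c : R) x y, M x -> M y -> M (x + c *: y).

(** The Mazur-Orlicz theorem for the norm and the cone spanned by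
    [M * {0}] and the pair [(- x, - d)]. *)
Lemma hahn_banach_separation (M : set E) (x : E) (d : R) :
  linear_subspace M -> 0 <= d -> (forall a, M a -> d <= `|x - a|) ->
  exists f : dual E, [/\ dual_ball E f, forall a, M a -> f a = 0 & d <= f x].
Proof.
move=> [M0 MD] d0 Md.
have MZ c a : M a -> M (c *: a) by move=> Ma; rewrite -[_ *: _]add0r; exact: MD.
pose C : set (E * R) := [set u | exists a c, [/\ M a, 0 <= c & u = (a - c *: x, - (c * d))]].
have [|u [a [c [Ma c0 ->]]]|f [lf fle fC]] := @mazur_orlicz R E _ C norm_sublinear.
- split.
  + by exists 0, 0; rewrite scale0r mul0r subr0 oppr0.
  + move=> _ _ [a [c [Ma c0 ->]]] [b [e [Mb e0 ->]]]; exists (a + b), (c + e); split.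
    * by rewrite -[b]scale1r; exact: MD.
    * exact: addr_ge0.
    * by congr (_, _); rewrite /= ?scalerDl ?mulrDl opprD// addrACA.
  + move=> t _ t0 [a [c [Ma c0 ->]]]; exists (t *: a), (t * c); split.
    * exact: MZ.
    * exact: mulr_ge0.
    * by congr (_, _); rewrite /= ?scalerBr ?scalerA// mulrN mulrA.
- rewrite /= opprB.
  have [->|cn0] := eqVneq c 0; first by rewrite mul0r subr0.
  have cp : 0 < c by rewrite lt0r cn0.
  have -> : c *: x - a = c *: (x - c^-1 *: a) by rewrite scalerBr scalerA divff// scale1r.
  by rewrite normrZ gtr0_norm// subr_ge0 ler_pM2l//; apply/Md/MZ.
have [g gf gb] := norm_dominated lf fle; exists g; rewrite gf.
have f0 : f 0 = 0 by have := lf 1 0 0; rewrite scale1r addr0 mul1r; lra.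
have fN y : f (- y) = - f y by rewrite -scaleN1r -[_ *: _]addr0 lf f0 mulN1r addr0.
have fa a : M a -> f a <= 0.
  by move=> Ma; apply: (fC (a, 0)); exists a, 0; rewrite scale0r subr0 mul0r oppr0.
split=> // [a Ma|].
  apply/eqP; rewrite eq_le fa//=; have := fa (- a); rewrite fN oppr_le0; apply.
  by rewrite -scaleN1r; exact: MZ.
rewrite -lerN2 -fN; apply: (fC (- x, - d)); exists 0, 1.
by rewrite scale1r sub0r mul1r.
Qed.

Lemma hahn_banach_norm (x : E) : exists f : dual E, dual_ball E f /\ f x = `|x|.
Proof.
have [|//||f [fb _ xf]] := @hahn_banach_separation [set 0] x `|x|.
- by split=> [//|c _ _ /= -> ->]; rewrite scaler0 addr0.
- by move=> a /= ->; rewrite subr0.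
- exists f; split=> //; apply/eqP; rewrite eq_le xf andbT.
  by have /dual_ballP/(_ x) := fb; apply: le_trans; exact: ler_norm.
Qed.

Lemma closure_normP (A : set E) x : closure A x <->
  forall e, 0 < e -> exists2 a, A a & `|x - a| < e.
Proof.
split=> [Ax e e0|Ax U /nbhs_ballP[e /= e0 eU]].
  by have [a [Aa]] := Ax _ (nbhsx_ballx x e e0); rewrite -ball_normE; exists a.
by have [a Aa xa] := Ax _ e0; exists a; split=> //; apply: eU; rewrite -ball_normE.
Qed.

Definition rational_subspace (A : set E) :=
  A 0 /\ forall (q : rat) x y, A x -> A y -> A (x + ratr q *: y).

Lemma rat_approx (c e : R) : 0 < e -> exists q : rat, `|c - ratr q| < e.
Proof.
move=> e0; have [q] : exists q : rat, ratr q \in `]c - e, c + e[.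
  by apply: rat_in_itvoo; lra.
by rewrite in_itv /= => /andP[h1 h2]; exists q; rewrite distrC ltr_norml; lra.
Qed.

Lemma closure_rational_subspace (A : set E) :
  rational_subspace A -> linear_subspace (closure A).
Proof.
move=> [A0 AD]; split=> [|c x y Ax Ay]; first exact: subset_closure.
apply/closure_normP => e e0.
have e3 : 0 < e / 3 by rewrite divr_gt0.
have [a Aa xa] := (closure_normP _ _).1 Ax _ e3.
have ypos : 0 < `|y| + 1 by rewrite ltr_wpDl.
have [q qP] := rat_approx c (divr_gt0 e3 ypos).
have cpos : 0 < `|ratr q : R| + 1 by rewrite ltr_wpDl.
have [b Ab yb] := (closure_normP _ _).1 Ay _ (divr_gt0 e3 cpos).
exists (a + ratr q *: b); first exact: AD.
have -> : x + c *: y - (a + ratr q *: b) = (x - a) + ((c - ratr q) *: y + ratr q *: (y - b)).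
  by rewrite scalerBl scalerBr subrKA addrACA -opprD.
apply: le_lt_trans (ler_normD _ _) _.
apply: le_lt_trans (lerD (lexx _) (ler_normD _ _)) _.
rewrite (normrZ (c - ratr q)) (normrZ (ratr q)).
have h1 : `|c - ratr q| * `|y| <= e / 3.
  apply: le_trans (_ : e / 3 / (`|y| + 1) * (`|y| + 1) <= _); last by rewrite divfK ?gt_eqF.
  by apply: ler_pM => //; [exact: ltW|rewrite lerDl].
have h2 : `|ratr q : R| * `|y - b| <= e / 3.
  apply: le_trans (_ : (`|ratr q : R| + 1) * (e / 3 / (`|ratr q : R| + 1)) <= _); last by rewrite mulrC divfK ?gt_eqF.
  by apply: ler_pM => //; [rewrite lerDl|exact: ltW].
lra.
Qed.

End HahnBanach.

Section WeakStar.
Context {R : realType} {E : normedModType R}.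
Local Notation X := (wstar_ball E).

Definition ev (x : E) (f : X) : R := set_val f x.

Lemma ev_le x (f : X) : `|ev x f| <= `|x|.
Proof. by case: f => f fb; apply: (dual_ballP f).1; move: fb; rewrite inE. Qed.

Lemma evP (a : R) (x y : E) (f : X) : ev (a *: x + y) f = a * ev x f + ev y f.
Proof. exact: clin_linear. Qed.

Lemma evD x y f : ev (x + y) f = ev x f + ev y f.
Proof. by rewrite -[x]scale1r evP scale1r mul1r. Qed.

Lemma ev0 f : ev 0 f = 0.
Proof. by rewrite /ev linear0. Qed.

Lemma evZ a x f : ev (a *: x) f = a * ev x f.
Proof. by rewrite -[_ *: _]addr0 evP ev0 addr0. Qed.

Lemma evN x f : ev (- x) f = - ev x f.
Proof. by rewrite -scaleN1r evZ mulN1r. Qed.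

Lemma evB x y f : ev (x - y) f = ev x f - ev y f.
Proof. by rewrite evD evN. Qed.

Definition in_ball (f : dual E) (fb : dual_ball E f) : X := SigSub (mem_set fb).

Lemma in_ballE f fb x : ev x (@in_ball f fb) = f x. Proof. by []. Qed.

Lemma ball_val (f : X) : dual_ball E (set_val f).
Proof. by case: f => f fb; exact: set_mem fb. Qed.

Lemma clin_ext (F : normedModType R) (f g : clin E F) : (forall x, f x = g x) -> f = g.
Proof. by move=> fg; apply: val_inj; apply/funext. Qed.

Lemma ev_inj (f g : X) : (forall x, ev x f = ev x g) -> f = g.
Proof. by move=> fg; apply: val_inj; exact: clin_ext. Qed.

Lemma wstar_weak : weak_topology (T := wstar E) (fun (x : E) (f : dual E) => f x : R).
Proof. exact: initial_family_weak. Qed.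

Lemma wstar_ball_weak : weak_topology ev.
Proof.
have [cw ww] := wstar_weak; split=> [x f|f U].
  exact: (continuous_comp (@initial_continuous _ (wstar E) _ f) (cw x (set_val f))).
rewrite nbhsE => -[_ [[W oW <-] Wf] WU].
have [s [e [e0 sW]]] := ww (set_val f) W (open_nbhs_nbhs (conj oW Wf)).
by exists s, e; split=> // g fg; apply: WU; exact: sW.
Qed.

Lemma ev_continuous x : continuous (ev x : X -> R^o).
Proof. exact: wstar_ball_weak.1. Qed.

Lemma sigma_weak (D : set (dual E)) :
  weak_topology (T := sigma D) (fun (f : set_type D) (x : E) => set_val f x : R).
Proof. exact: initial_family_weak. Qed.

(** An ultrafilter on the ball converges pointwise, since its image under each
    evaluation lives in a segment; the limit is a functional of the ball. *)
Theorem banach_alaoglu : compact [set: X].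
Proof.
rewrite compact_ultra => F FU _.
have FP : ProperFilter F by apply: ultra_proper.
have cvx x : exists l : R, (ev x f : R^o) @[f --> F] --> (l : R^o).
  have /(_ ((fun f => ev x f : R^o) @ F)) [|l [_ lcl]] := @segment_compact R (- `|x|) `|x|.
    change (F (ev x @^-1` [set` `[- `|x|, `|x|]])).
    by apply: filterE => f; rewrite /= in_itv /= -ler_norml; exact: ev_le.
  exists l => U /= Ul; have [//|FnU] := in_ultra_setVsetC (ev x @^-1` U) FU.
  by have [y [/= ? ?]] := lcl (~` U) U FnU Ul.
have [g gP] := choice cvx.
have lg a x y : g (a *: x + y) = a * g x + g y.
  have cg : (ev (a *: x + y) f : R^o) @[f --> F] --> (a * g x + g y : R^o).
    under eq_fun do rewrite evP.
    by apply: cvgD; [apply: cvgM; [exact: cvg_cst|]|]; exact: gP.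
  exact: (norm_cvg_unique (gP _) cg).
have gle x : g x <= `|x|.
  apply: (@closed_cvg _ _ F _ (ev x) [set y | y <= `|x|] _ _ _ (gP x)); first exact: closed_le.
  by apply: filterE => f /=; apply: le_trans (ler_norm _) (ev_le x f).
have [h hg hb] := norm_dominated lg gle.
exists (in_ball hb); split=> //; apply: (weak_topology_cvg wstar_ball_weak) => x.
by rewrite in_ballE hg; exact: gP.
Qed.

End WeakStar.

(** * Countable dense selections and Skolem hulls *)

Lemma exists_natSinv_lt {R : realType} (e : R) : 0 < e -> exists n : nat, n.+1%:R^-1 < e.
Proof.
move=> e0; have [n _ nP] : \forall n \near \oo, n.+1%:R^-1 < e by exact: near_infty_natSinv_lt (PosNum e0).
by exists n; apply: nP => /=.
Qed.

Lemma countable_setU (T : Type) (A B : set T) :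
  countable A -> countable B -> countable (A `|` B).
Proof.
move=> cA cB; have -> : A `|` B = \bigcup_(b : bool) (if b then A else B).
  by apply/seteqP; split=> [x []|x [[] _ ?]]; [exists true|exists false|left|right].
by apply: bigcup_countable => [|[] _].
Qed.

Lemma countable_enum (T : Type) (A : set T) : countable A -> A !=set0 ->
  exists a : nat -> T, range a = A.
Proof.
move=> /countable_injP[f fi] [x0 Ax0].
have /choice[a aP] : forall n, exists x, A x /\ forall y, A y -> f y = n -> x = y.
  move=> n; have [[y [Ay fy]]|none] := pselect (exists y, A y /\ f y = n).
    by exists y; split=> // z Az fz; apply: fi; rewrite ?inE// fy.
  by exists x0; split=> // y Ay fy; case: none; exists y.
exists a; apply/seteqP; split=> [_ [n _ <-]|x Ax]; first exact: (aP n).1.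
by exists (f x) => //; exact: (aP (f x)).2.
Qed.

(** One point of [T] is chosen for every rational box that [T] meets. *)
Lemma countable_selection {R : realType} (X : Type) (J : finType) (phi : X -> J -> R) (T : set X) :
  exists S : set X, [/\ countable S, S `<=` T &
    forall t, T t -> forall e : R, 0 < e ->
      exists2 s, S s & forall j, `|phi t j - phi s j| < e].
Proof.
pose near_pt (p : {ffun J -> rat} * nat) t :=
  T t /\ forall j, `|phi t j - ratr (p.1 j)| < p.2.+1%:R^-1.
have sel p : exists S : set X, [/\ countable S, S `<=` near_pt p &
    (exists t, near_pt p t) -> S !=set0].
  have [[t pt]|nt] := pselect (exists t, near_pt p t).
    exists [set t]; split=> [|s ->//|_]; first exact: countable1.
    by exists t.
  by exists set0; split=> // ; exact: countable0.
have [S SP] := choice sel; exists (\bigcup_p S p); split.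
- by apply: bigcup_countable => [|p _]; [exact: countableP|have [] := SP p].
- by move=> t [p _ /[dup] St]; have [_ Sp _] := SP p; move/Sp => -[].
- move=> t Tt e e0; have e2 : 0 < e / 2 by rewrite divr_gt0.
  have [n ne] := exists_natSinv_lt e2.
  have n0 : 0 < n.+1%:R^-1 :> R by rewrite invr_gt0.
  have [q qP] := choice (fun j => rat_approx (phi t j) n0).
  have [|s Ss] := let: And3 _ _ h := SP ([ffun j => q j], n) in h.
    by exists t; split=> // j /=; rewrite ffunE.
  have [_ /(_ s Ss)[_ sq] _] := SP ([ffun j => q j], n).
  exists s; first by exists ([ffun j => q j], n).
  move=> j; have := sq j; rewrite /= ffunE => h1; have := qP j => h2.
  have := ler_distD (ratr (q j)) (phi t j) (phi s j); rewrite (distrC (ratr _)); move: ne h1 h2; move: (n.+1%:R^-1 : R) => d; lra.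
Qed.

Section SkolemHull.
Context {U : Type} (c : seq U -> set U).

(** The rule [c] stands for countably many Skolem functions: [c l] collects
    their values at the parameters [l]. *)
Definition seq_in (H : set U) (l : seq U) := foldr (fun u P => H u /\ P) True l.

Definition closed_under (H : set U) := forall l, seq_in H l -> c l `<=` H.

Definition hull (X : set U) := \bigcap_(H in [set H | X `<=` H /\ closed_under H]) H.

Lemma seq_in_sub (H K : set U) l : H `<=` K -> seq_in H l -> seq_in K l.
Proof. by move=> HK; elim: l => //= u l IH [/HK ? /IH]. Qed.

Lemma nondecreasing_chain (H : nat -> set U) : (forall n, H n `<=` H n.+1) ->
  forall m n, (m <= n)%N -> H m `<=` H n.
Proof.
move=> incH m; elim=> [|n IH]; first by rewrite leqn0 => /eqP->.
by rewrite leq_eqVlt => /predU1P[->//|/IH]; move/subset_trans; apply.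
Qed.

Lemma seq_in_bigcup (H : nat -> set U) l : (forall n, H n `<=` H n.+1) ->
  seq_in (\bigcup_n H n) l -> exists n, seq_in (H n) l.
Proof.
move=> incH; elim: l => [_|u l IH]; first by exists 0%N.
move=> /= [[m _ Hu] /IH[n Hl]]; exists (maxn m n); split.
  by apply: nondecreasing_chain Hu => //; exact: leq_maxl.
by apply: seq_in_sub Hl; apply: nondecreasing_chain => //; exact: leq_maxr.
Qed.

Lemma closed_under_bigcup (H : nat -> set U) : (forall n, H n `<=` H n.+1) ->
  (forall n, closed_under (H n)) -> closed_under (\bigcup_n H n).
Proof. by move=> incH cH l /(seq_in_bigcup incH)[n /cH Hn u /Hn]; exists n. Qed.

Lemma hull_min X H : X `<=` H -> closed_under H -> hull X `<=` H.
Proof. by move=> XH cH u; apply; split. Qed.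

Lemma sub_hull X : X `<=` hull X.
Proof. by move=> u Xu H [XH _]; exact: XH. Qed.

Lemma hull_closed X : closed_under (hull X).
Proof.
move=> l lX u cu H [XH cH]; apply: (cH l) => //; apply: seq_in_sub lX.
by move=> v; apply; split.
Qed.

Lemma hull_subset X Y : X `<=` Y -> hull X `<=` hull Y.
Proof.
by move=> XY; apply: hull_min; [exact: subset_trans (@sub_hull Y)|exact: hull_closed].
Qed.

(** Each element of a hull is reached after finitely many applications of
    [c] to finite lists, so it involves finitely many generators only. *)
Lemma hull_bigcup (X : nat -> set U) : (forall n, X n `<=` X n.+1) ->
  hull (\bigcup_n X n) = \bigcup_n hull (X n).
Proof.
move=> incX; apply/seteqP; split=> [|u [n _]].
  apply: hull_min => [u [n _ Xu]|]; first by exists n => //; exact: sub_hull.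
  apply: closed_under_bigcup => n; last exact: hull_closed.
  exact: hull_subset.
by apply: hull_subset => v Xv; exists n.
Qed.

Lemma countable_seq_in (H : set U) : countable H -> countable (seq_in H).
Proof.
move=> /countable_injP[f fi]; apply/countable_injP; exists (fun l => choice.pickle (map f l)).
move=> l m; rewrite !inE => Hl Hm /(pcan_inj choice.pickleK).
elim: l m Hl Hm => [|u l IH] [|v m] //= [Hu Hl] [Hv Hm] [fuv flm].
by congr (_ :: _); [apply: fi; rewrite ?inE|exact: IH].
Qed.

Hypothesis c_countable : forall l, countable (c l).

Lemma countable_hull X : countable X -> countable (hull X).
Proof.
move=> cX; pose step (H : set U) := H `|` \bigcup_(l in seq_in H) c l.
pose H n := iter n step X.
have incH n : H n `<=` H n.+1 by move=> u; left.
have cH n : countable (H n).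
  elim: n => //= n IH; apply: countable_setU => //.
  by apply: bigcup_countable => [|l _] //; exact: countable_seq_in.
suff : hull X `<=` \bigcup_n H n.
  by move/subset_card_le/sub_countable; apply; apply: bigcup_countable.
apply: hull_min => [u Xu|l lH u cu]; first by exists 0%N.
have [n Hl] := seq_in_bigcup incH lH.
by exists n.+1 => //; right; exists l.
Qed.

End SkolemHull.

(** * Metrization by a sequence of functions *)

(** The bare carrier of a space, on which a metric can be declared without
    inheriting the given topology. *)
Definition metric_copy (T : Type) : Type := T.
HB.instance Definition _ (T : choiceType) := Choice.on (metric_copy T).

Section Metrization.
Context {R : realType} {T : topologicalType} (f : nat -> T -> R).
Hypothesis f_weak : weak_topology f.
Hypothesis f_inj : forall x y, (forall n, f n x = f n y) -> x = y.

(** The truncation at [1 / (n + 1)] makes each ball depend on finitely many of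
    the functions. *)
Definition weak_dist_set (x y : T) : set R :=
  [set Num.min `|f n x - f n y| n.+1%:R^-1 | n in [set: nat]].
Definition weak_dist (x y : T) : R := sup (weak_dist_set x y).

Lemma weak_dist_has_sup x y : has_sup (weak_dist_set x y).
Proof.
split; first by exists (Num.min `|f 0%N x - f 0%N y| 1%:R^-1); exists 0%N.
exists 1 => _ [n _ <-]; rewrite ge_min; apply/orP; right.
by rewrite invf_le1 ?ltr0n// ler1n.
Qed.

Lemma weak_dist_ge x y n : Num.min `|f n x - f n y| n.+1%:R^-1 <= weak_dist x y.
Proof. by apply: ub_le_sup; [have [] := weak_dist_has_sup x y|exists n]. Qed.

Lemma weak_dist_le x y (e : R) :
  (forall n, Num.min `|f n x - f n y| n.+1%:R^-1 <= e) -> weak_dist x y <= e.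
Proof.
by move=> le_e; apply: ge_sup => [|_ [n _ <-]//]; have [] := weak_dist_has_sup x y.
Qed.

Lemma weak_dist_lt x y n (e : R) : e <= n.+1%:R^-1 -> weak_dist x y < e ->
  `|f n x - f n y| < e.
Proof.
move=> en xye; have := le_lt_trans (weak_dist_ge x y n) xye.
by rewrite gt_min => /orP[//|]; rewrite ltNge en.
Qed.

Lemma weak_metrizable : metrizable R T.
Proof.
have dxx x : weak_dist x x = 0.
  apply/eqP; rewrite eq_le; apply/andP; split.
    by apply: weak_dist_le => n; rewrite ge_min subrr normr0 lexx.
  by apply: le_trans (weak_dist_ge x x 0%N); rewrite le_min normr_ge0 invr_ge0 ler0n.
have d_pos x y : weak_dist x y = 0 -> x = y.
  move=> xy; apply: f_inj => n; have := weak_dist_ge x y n; rewrite xy ge_min.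
  by rewrite normr_le0 subr_eq0 => /orP[/eqP//|]; rewrite leNgt invr_gt0 ltr0n.
have d_sym x y : weak_dist x y = weak_dist y x.
  by congr sup; apply/seteqP; split=> _ [n _ <-]; exists n; rewrite // distrC.
have d_tri y x z : weak_dist x z <= weak_dist x y + weak_dist y z.
  apply: weak_dist_le => n; have := weak_dist_ge x y n; have := weak_dist_ge y z n.
  have := ler_distD (f n y) (f n x) (f n z).
  have : 0 <= n.+1%:R^-1 :> R by rewrite invr_ge0.
  move: (n.+1%:R^-1 : R) => d.
  move: `|_ - f n z| `|f n x - f n y| (normr_ge0 (f n x - f n y)) (normr_ge0 (f n y - f n z)).
  move: `|_ - _| => a b c; rewrite !ge_min.
  by move=> c0 a0 d0 bca /orP[h1|h1] /orP[h2|h2]; apply/orP; by [left; lra|right; lra].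
pose mx := isMetric.Build R (metric_copy T) dxx d_pos d_sym d_tri.
pose M : metricType R := HB.pack (metric_copy T) mx.
exists (Metric.class M); apply/seteqP.
suff nbhsE (x : T) (A : set T) : nbhs (x : M) (A : set M) <-> nbhs x A.
  by split=> A; rewrite !openE => Ao x /Ao /nbhsE.
split=> [/nbhs_ballP[e /= e0 eA]|/f_weak.2[s [e [e0 sA]]]].
  have [N Ne] := exists_natSinv_lt e0.
  have e2 : 0 < e / 2 by rewrite divr_gt0.
  suff : \forall y \near x, forall n, (n < N)%N -> `|f n x - f n y| < e / 2.
    apply: filterS => y xy; apply: eA; rewrite ballEmdist /=.
    have : weak_dist x y <= Num.max (e / 2) N.+1%:R^-1; last first.
      by move/le_lt_trans; apply; rewrite gt_max Ne; lra.
    apply: weak_dist_le => n; rewrite le_max !ge_min.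
    have [nN|Nn] := ltnP n N; first by rewrite ltW// xy.
    by rewrite (lef_pV2 (y := N.+1%:R)) ?posrE// ler_nat ltnS Nn !orbT.
  elim: {Ne} N => [|N IH]; first by apply: filterE.
  have /cvgrPdist_lt/(_ _ e2) fN := f_weak.1 N x.
  near=> y => n; rewrite ltnS leq_eqVlt => /predU1P[->|nN]; first by near: y.
  by have : forall n, (n < N)%N -> `|f n x - f n y| < e / 2; [near: y|apply].
pose N := (\max_(n <- s) n)%N; pose d := Num.min e N.+1%:R^-1.
have d0 : 0 < d by rewrite lt_min e0 invr_gt0 ltr0n.
apply/nbhs_ballP; exists d => //= y; rewrite ballEmdist /= => xyd.
apply: sA => n sn; rewrite distrC.
have nN : (n <= N)%N by exact: (leq_bigmax_seq (F := id)).
apply: (@lt_le_trans _ _ d); last by rewrite ge_min lexx.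
apply: weak_dist_lt xyd; rewrite ge_min; apply/orP; right.
by rewrite lef_pV2 ?posrE ?ltr0n// ler_nat.
Unshelve. all: by end_near. Qed.

End Metrization.

(** * From projections to retractions *)

Lemma weak_topology_subtype {R : realType} {T : topologicalType} {I : choiceType}
    (f : I -> T -> R) (A : set T) : weak_topology f ->
  weak_topology (T := set_type A) (fun i t => f i (set_val t)).
Proof.
move=> [cf wf]; split=> [i t|t U].
  exact: (continuous_comp (@initial_continuous _ T _ t) (cf i (set_val t))).
rewrite nbhsE => -[_ [[W oW <-] Wt] WU].
have [s [e [e0 sW]]] := wf (set_val t) W (open_nbhs_nbhs (conj oW Wt)).
by exists s, e; split=> // u ut; apply: WU; exact: sW.
Qed.

Lemma tail_filter_proper {d : Order.disp_t} (G : porderType d) :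
  up_directed G -> ProperFilter (tail_filter G).
Proof.
move=> [[s0 _] dG]; apply: filter_from_proper => [|s _]; last by exists s => /=.
apply: filter_from_filter; first by exists s0.
move=> s t _ _; have [u [su tu]] := dG s t.
by exists u => // v /= uv; split; exact: le_trans uv.
Qed.

Section DualAlgebra.
Context {R : realType} {E : normedModType R}.

Lemma dualP (a : R) (f g : dual E) x : (a *: f + g) x = a * f x + g x.
Proof. by []. Qed.

Lemma dualZ (a : R) (f : dual E) x : (a *: f) x = a * f x.
Proof. by []. Qed.

Lemma dual_sumE n (c : 'I_n -> R) (a : 'I_n -> dual E) x :
  (\sum_i c i *: a i) x = \sum_i c i * a i x.
Proof. by elim/big_rec2: _ => [//|i y g _ <-]; rewrite dualP. Qed.

Lemma adjointE (P : clin E E) (f : dual E) x : adjoint P f x = f (P x).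
Proof. by []. Qed.

Lemma dual_ball_adjoint (P : clin E E) (f : dual E) :
  opnorm P <= 1 -> dual_ball E f -> dual_ball E (adjoint P f).
Proof.
move=> /opnorm_le1P P1 /dual_ballP f1; apply/dual_ballP => x.
exact: le_trans (f1 _) (P1 x).
Qed.

Lemma dual_ball_conv (t : R) (f g : dual E) : 0 <= t <= 1 ->
  dual_ball E f -> dual_ball E g -> dual_ball E (t *: f + (1 - t) *: g).
Proof.
move=> /andP[t0 t1] /dual_ballP f1 /dual_ballP g1; apply/dual_ballP => x.
rewrite dualP dualZ; apply: le_trans (ler_normD _ _) _; rewrite !normrM.
have u0 : 0 <= 1 - t by rewrite subr_ge0.
rewrite (ger0_norm t0) (ger0_norm u0).
have -> : `|x| = t * `|x| + (1 - t) * `|x| by rewrite -mulrDl addrC subrK mul1r.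
by apply: lerD; apply: ler_wpM2l; rewrite ?subr_ge0.
Qed.

Lemma dual_ballN (f : dual E) : dual_ball E f -> dual_ball E (- f).
Proof.
move=> /dual_ballP f1; apply/dual_ballP => x.
by have := dualP (-1) f 0 x; rewrite scaleN1r addr0 => ->; rewrite mulN1r addr0 normrN.
Qed.

Lemma sub_lin_span (A : set (dual E)) (c : R) a : A a -> lin_span A (c *: a).
Proof.
by move=> Aa; exists 1%N, (fun=> c), (fun=> a); split=> //; rewrite big_ord1.
Qed.

End DualAlgebra.

Section ProjectionalToRetractional.
Context {R : realType} {E : normedModType R}.
Context {d : Order.disp_t} {G : porderType d} (P : G -> clin E E).
Hypothesis P_skel : one_projectional_skeleton P.
Local Notation X := (wstar_ball E).

Let P_le1 s : opnorm (P s) <= 1 := P_skel.2 s.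
Let P_contr s x : `|P s x| <= `|x| := (opnorm_le1P (P s)).1 (P_le1 s) x.

Let PP s x : P s (P s x) = P s x.
Proof. exact: (congr1 (fun h => h x) (pskel_proj P_skel.1 s)). Qed.

Let P_fix s t x : (s <= t)%O -> P t (P s x) = P s x.
Proof. by move=> /(pskel_comp P_skel.1)[_ /(congr1 (fun h => h x))]. Qed.

Let P_absorb s t x : (s <= t)%O -> P s (P t x) = P s x.
Proof. by move=> /(pskel_comp P_skel.1)[/(congr1 (fun h => h x))]. Qed.

Lemma adjoint_range_lin (a : R) (f g : dual E) :
  (\bigcup_s range (adjoint (P s))) f -> (\bigcup_s range (adjoint (P s))) g ->
  (\bigcup_s range (adjoint (P s))) (a *: f + g).
Proof.
move=> [s _ [f' _ <-]] [t _ [g' _ <-]].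
have [u [su tu]] := (pskel_directed P_skel.1).2 s t.
exists u => //; exists (a *: adjoint (P s) f' + adjoint (P t) g') => //.
by apply: clin_ext => x; rewrite adjointE !dualP !adjointE !P_absorb.
Qed.

Definition adjoint_retraction s (f : X) : X :=
  in_ball (dual_ball_adjoint (P_le1 s) (ball_val f)).

Lemma ev_adjoint_retraction s x f : ev x (adjoint_retraction s f) = ev (P s x) f.
Proof. by []. Qed.

Lemma adjoint_retraction_continuous s : continuous (adjoint_retraction s).
Proof.
apply: (weak_topology_continuous wstar_ball_weak) => x.
by have := @ev_continuous R E (P s x).
Qed.

(** A functional in the range of [r_s] is determined by its values on the
    separable space [P_s E]. *)
Lemma adjoint_retraction_metrizable s :
  metrizable R (set_type (range (adjoint_retraction s))).
Proof.
have [C [cC CP PC]] := pskel_separable P_skel.1 s.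
have rE x (f : set_type (range (adjoint_retraction s))) :
    ev x (set_val f) = ev (P s x) (set_val f).
  by rewrite set_valE; have [g _ <-] := set_mem (valP f); rewrite !ev_adjoint_retraction PP.
have [x0 Cx0] : C !=set0.
  have [x [Cx _]] := PC (P s 0) (imageT _ _) setT filterT; by exists x.
have [a aC] : exists a : nat -> E, range a = C by apply: countable_enum => //; exists x0.
have app x e : 0 < e -> exists n, `|P s x - a n| < e.
  move=> e0; have [y] := (closure_normP _ _).1 (PC _ (imageT (P s) x)) _ e0.
  by rewrite -aC => -[n _ <-]; exists n.
have ev_near x y (f : X) : `|ev x f - ev y f| <= `|x - y| by rewrite -evB; exact: ev_le.
have [cw ww] := weak_topology_subtype (range (adjoint_retraction s)) (@wstar_ball_weak R E).
apply: (@weak_metrizable _ _ (fun n f => ev (a n) (set_val f))).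
- split=> [n|f U /ww[l [e [e0 lU]]]]; first exact: cw.
  have e3 : 0 < e / 3 by rewrite divr_gt0.
  have [n nP] := choice (fun x => app x _ e3).
  exists (map n l), (e / 3); split=> // g gP; apply: lU => x xl.
  have := gP (n x) (map_f n xl); rewrite (rE x g) (rE x f) => h.
  have := ev_near (P s x) (a (n x)) (set_val g); have := ev_near (P s x) (a (n x)) (set_val f).
  have := nP x; move: h; rewrite -/(ev _ _).
  rewrite !ltr_norml !ler_norml; lra.
- move=> f g fg; apply: val_inj; apply: ev_inj => x; rewrite -!set_valE (rE x f) (rE x g).
  apply/eqP; rewrite -subr_eq0 -normr_le0; apply/ler_addgt0Pr => e e0; rewrite add0r.
  have e2 : 0 < e / 2 by rewrite divr_gt0.
  have [n nP] := app x _ e2; have := fg n.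
  have := ev_near (P s x) (a n) (set_val g); have := ev_near (P s x) (a n) (set_val f).
  move: nP; rewrite !ler_norml; lra.
Qed.

Lemma adjoint_retractional_skeleton : retractional_skeleton R adjoint_retraction.
Proof.
have [[dP projP sepP covP compP supP] _] := P_skel; split => //.
- exact: compact_countably_compact banach_alaoglu.
- move=> s; split; first exact: adjoint_retraction_continuous.
  by apply/funext => f; apply: ev_inj => x; rewrite !ev_adjoint_retraction PP.
- move=> s; apply: continuous_compact; last exact: banach_alaoglu.
  exact/continuous_subspaceT/adjoint_retraction_continuous.
- exact: adjoint_retraction_metrizable.
- move=> s t st; split; apply/funext => f; apply: ev_inj => x /=;
    by rewrite !ev_adjoint_retraction ?(P_fix x st) ?(P_absorb x st).
- move=> s incs; have [t [tlub tcl]] := supP s incs; exists t; split=> // f.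
  apply: (weak_topology_cvg wstar_ball_weak) => x; rewrite ev_adjoint_retraction.
  apply/cvgrPdist_lt => e e0; have e2 : 0 < e / 2 by rewrite divr_gt0.
  have : closure (\bigcup_n range (P (s n))) (P t x) by rewrite -tcl; exact: imageT.
  move=> /closure_normP/(_ _ e2)[_ [N _ [y _ <-]] Pe].
  exists N => // n /= Nn; rewrite ev_adjoint_retraction -evB.
  have sNn : (s N <= s n)%O.
    by apply: (homo_leq (@lexx _ G) (@le_trans _ G)) Nn => k; exact/ltW/incs.
  have snt : (s n <= t)%O by apply: tlub.1; exists n.
  rewrite -(P_absorb x snt); apply: le_lt_trans (ev_le _ _) _.
  (* [P_n] fixes the approximant [P_N y]. *)
  have -> : P t x - P (s n) (P t x) =
      (P t x - P (s N) y) - P (s n) (P t x - P (s N) y).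
    by rewrite linearB /= (P_fix y sNn) opprB addrA subrK.
  apply: le_lt_trans (ler_normB _ _) _.
  have := P_contr (s n) (P t x - P (s N) y); lra.
- move=> f; have FG := tail_filter_proper dP.
  apply: (weak_topology_cvg wstar_ball_weak) => x.
  have [s _ [y _ sx]] : (\bigcup_s range (P s)) x by rewrite covP.
  apply: cvg_near_cst; exists s => // t st.
  by rewrite /= ev_adjoint_retraction -sx P_fix.
Qed.

End ProjectionalToRetractional.

Theorem retractional_of_projectional {R : realType} {E : normedModType R}
    (D : set (dual E)) :
  induced_by_one_projectional_skeleton (lin_span D) ->
  lin_span D `&` dual_ball E = D ->
  [/\ @convex_set R (dual E) D, symmetric_set D &
    induced_by_retractional_skeleton R (ball_trace D)].
Proof.
move=> [d [G [P [Pskel spanD]]]] ballD.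
have spanDP (a : R) f g : lin_span D f -> lin_span D g -> lin_span D (a *: f + g).
  by rewrite spanD; exact: adjoint_range_lin.
have D_span f : D f -> lin_span D f by rewrite -{1}ballD => -[].
have D_ball f : D f -> dual_ball E f by rewrite -{1}ballD => -[].
split.
- move=> f g t; rewrite !inE => Df Dg.
  have t01 : 0 <= t%:num <= 1 by apply/andP; split.
  rewrite -ballD; split; last exact: (dual_ball_conv t01 (D_ball _ Df) (D_ball _ Dg)).
  apply: (spanDP t%:num f); first exact: D_span.
  exact: sub_lin_span.
- move=> f Df; rewrite -ballD; split; last exact/dual_ballN/D_ball.
  by rewrite -scaleN1r; exact: sub_lin_span.
- exists d, G, (adjoint_retraction Pskel); split.
    exact: adjoint_retractional_skeleton.
  apply/seteqP; split=> [f /D_span|f [s _ [g _ <-]]].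
    rewrite spanD => -[s _ [g _ fE]]; exists s => //; exists f => //.
    apply: ev_inj => x; rewrite ev_adjoint_retraction.
    rewrite /ev -fE !adjointE.
    by have /(congr1 (fun h => h x)) /= -> := pskel_proj Pskel.1 s.
  rewrite /ball_trace /= -ballD; split; last exact: ball_val.
  by rewrite spanD; exists s => //; exists (set_val g).
Qed.

(** * From the Sokolov property to projections *)

Section CountableClosedSets.
Context {U : Type} (c : seq U -> set U).

(** Ordered by inclusion, these sets are the indices of the projectional
    skeleton. *)
Record skolem_set := SkolemSet {
  skolem_carrier :> set U ;
  skolem_setP : countable skolem_carrier /\ closed_under c skolem_carrier }.

Lemma skolem_set_ext (H K : skolem_set) : (H : set U) = K -> H = K.
Proof. by case: H K => [H h] [K k] /= E; subst K; congr SkolemSet; exact: Prop_irrelevance. Qed.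

HB.instance Definition _ := gen_eqMixin skolem_set.
HB.instance Definition _ := gen_choiceMixin skolem_set.

Definition skolem_le (H K : skolem_set) := `[< (H : set U) `<=` K >].

Lemma skolem_le_refl : reflexive skolem_le.
Proof. by move=> H; apply/asboolP. Qed.

Lemma skolem_le_anti : antisymmetric skolem_le.
Proof.
move=> H K /andP[/asboolP HK /asboolP KH]; apply: skolem_set_ext; exact/seteqP.
Qed.

Lemma skolem_le_trans : transitive skolem_le.
Proof. move=> K H L /asboolP HK /asboolP KL; apply/asboolP; exact: subset_trans KL. Qed.

HB.instance Definition _ := Order.Le_isPOrder.Build (Order.Disp tt tt) skolem_set
  skolem_le_refl skolem_le_anti skolem_le_trans.

Lemma skolem_leP (H K : skolem_set) : (H <= K)%O <-> (H : set U) `<=` K.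
Proof. by split=> [/asboolP|HK]; last exact/asboolP. Qed.

Hypothesis c_countable : forall l, countable (c l).

Lemma skolem_set_exists (X : set U) : countable X -> exists H : skolem_set, X `<=` H.
Proof.
move=> cX.
by exists (SkolemSet (conj (countable_hull c_countable cX) (@hull_closed _ c X))); exact: sub_hull.
Qed.

Lemma skolem_directed : up_directed skolem_set.
Proof.
split; first by have [H _] := skolem_set_exists (@countable0 U); exists H.
move=> H K.
have cHK := countable_setU (skolem_setP H).1 (skolem_setP K).1.
by have [L HKL] := skolem_set_exists cHK; exists L; split; apply/skolem_leP => u Hu;
  apply: HKL; [left|right].
Qed.

Lemma skolem_sup (s : nat -> skolem_set) : (forall n, (s n < s n.+1)%O) ->
  exists t : skolem_set, isLub (range s) t /\ (t : set U) = \bigcup_n (s n : set U).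
Proof.
move=> incs; have inc n : (s n : set U) `<=` s n.+1 by apply/skolem_leP/ltW.
have ct : countable (\bigcup_n (s n : set U)).
  by apply: bigcup_countable => // n _; exact: (skolem_setP (s n)).1.
have cc : closed_under c (\bigcup_n (s n : set U)).
  by apply: closed_under_bigcup => // n; exact: (skolem_setP (s n)).2.
exists (SkolemSet (conj ct cc)); split=> //; split=> [_ [n _ <-]|H ubH].
  by apply/skolem_leP => u su; exists n.
apply/skolem_leP => u [n _ su].
by have /skolem_leP : (s n <= H)%O by [apply: ubH; exists n]; apply.
Qed.

End CountableClosedSets.

Section DenseSets.
Context {R : realType} {E : normedModType R} (D : set (dual E)).
Hypothesis D_ball : D `<=` dual_ball E.
Hypothesis D_dense : dense (ball_trace D).
Local Notation X := (wstar_ball E).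

Definition approximates (B : set (dual E)) (A : set E) (g : dual E) :=
  forall (s : seq E) (e : R), (forall x, x \in s -> A x) -> 0 < e ->
    exists2 b, B b & forall x, x \in s -> `|b x - g x| < e.

Lemma dense_approximates (g : dual E) : dual_ball E g -> approximates D setT g.
Proof.
move=> gb s e _ e0.
pose g' : X := in_ball gb.
have ng := weak_topology_nbhs g' s e0 (@wstar_ball_weak R E).
have [||f [/interior_subset fs Df]] := D_dense (O := interior [set f : X | forall x, x \in s -> `|ev x f - ev x g'| < e]).
- by exists g'.
- exact: open_interior.
- by exists (set_val f).
Qed.

(** Countable compactness turns approximation on the finite subsets of a
    countable set into equality on that set. *)
Lemma countably_compact_interpolation (A : set E) (B : set (dual E)) (g : dual E) :
  countably_compact (D : set (wstar E)) -> countable A -> B `<=` D ->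
  approximates B A g ->
  exists d, [/\ D d, forall x, A x -> d x = g x & approximates B setT d].
Proof.
move=> ccD cA BD BA.
pose W : topologicalType := wstar E.
have cev x : continuous ((fun f : W => (f : dual E) x) : W -> R^o) := wstar_weak.1 x.
have [a aA] : exists a : nat -> E, range a = 0 |` A.
  by apply: countable_enum; [exact: countable_setU (countable1 0) cA|exists 0; left].
pose Z n : set W := closure (B : set W) `&`
  [set f : W | forall i, (i <= n)%N -> `|(f : dual E) (a i) - g (a i)| <= n.+1%:R^-1].
have cZ n : closed (Z n).
  apply: closedI; first exact: closed_closure.
  have -> : [set f : W | forall i, (i <= n)%N -> `|(f : dual E) (a i) - g (a i)| <= n.+1%:R^-1] =
    \bigcap_(i in [set i | (i <= n)%N]) [set f : W | `|(f : dual E) (a i) - g (a i)| <= n.+1%:R^-1] by [].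
  apply: closed_bigI => i _; apply: closed_le_continuous; last exact: cst_continuous.
  by apply: continuous_abs; apply: continuous_sub; [exact: cev|exact: cst_continuous].
have decZ n : Z n.+1 `<=` Z n.
  move=> f [fB fa]; split=> // i ni; apply: le_trans (fa i (leqW ni)) _.
  by rewrite lef_pV2 ?posrE ?ltr0n// ler_nat.
have neZ n : exists f : W, D f /\ Z n f.
  have n0 : 0 < n.+1%:R^-1 :> R by rewrite invr_gt0.
  have [|b Bb ba] := BA [seq x <- map a (iota 0 n.+1) | x != 0] _ _ n0.
    move=> x; rewrite mem_filter => /andP[x0 /mapP[i _ xi]].
    by have : (0 |` A) x by [rewrite -aA xi; exists i]; case=> // /eqP; rewrite (negbTE x0).
  exists b; split; first exact: BD.
  split; first exact: subset_closure.
  move=> i ni; have [->|ai0] := eqVneq (a i) 0.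
    by rewrite (linear0 (b : clin E R^o)) (linear0 (g : clin E R^o)) subrr normr0 ltW.
  by apply/ltW/ba; rewrite mem_filter ai0; apply: map_f; rewrite mem_iota.
have [d [Dd dZ]] := countably_compact_decreasing ccD cZ decZ neZ.
exists d; split=> // [x Ax|s e _ e0].
  have [i _ <-] : range a x by rewrite aA; right.
  apply/eqP; rewrite -subr_eq0 -normr_le0; apply: le_add_natSinv => n.
  have [_ /(_ i (leq_maxl i n)) h] := dZ (maxn i n).
  rewrite add0r; apply: le_trans h _.
  by rewrite lef_pV2 ?posrE ?ltr0n// ler_nat ltnS leq_maxr.
have [dB _] := dZ 0%N; have [b [Bb bd]] := dB _ (weak_topology_nbhs d s e0 wstar_weak).
by exists b.
Qed.

Lemma exists_hitting : exists hit : seq E -> set (dual E), forall s,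
  [/\ countable (hit s), hit s `<=` D &
    forall d e, D d -> 0 < e -> exists2 b, hit s b &
      forall x, x \in s -> `|b x - d x| < e].
Proof.
suff /choice[hit hitP] : forall s : seq E, exists B : set (dual E),
    [/\ countable B, B `<=` D & forall d (e : R), D d -> 0 < e ->
      exists2 b, B b & forall x, x \in s -> `|b x - d x| < e].
  by exists hit.
move=> s.
have [S [cS SD hS]] := @countable_selection R _ 'I_(size s) (fun (d : dual E) j => d (nth 0 s j)) D.
exists S; split=> // d e Dd e0; have [b Sb bP] := hS d Dd e e0.
exists b => // x; move=> /(nthP 0)[i si <-].
by have := bP (Ordinal si); rewrite distrC.
Qed.

Lemma approximates_hitting (A : set E) (B : set (dual E)) (g : dual E) :
  dual_ball E g ->
  (forall (s : seq E) d e, (forall x, x \in s -> A x) -> D d -> 0 < e ->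
    exists2 b, B b & forall x, x \in s -> `|b x - d x| < e) ->
  approximates B A g.
Proof.
move=> gb hB s e sA e0; have e2 : 0 < e / 2 by rewrite divr_gt0.
have [d Dd dg] := dense_approximates gb (fun _ _ => I) e2 (s := s).
have [b Bb bd] := hB s d _ sA Dd e2; exists b => // x xs.
have := dg x xs; have := bd x xs; rewrite !ltr_norml; lra.
Qed.

(** On [closure A] the functionals of [B] compute the norm, so a vector of
    [closure A] is determined by them; the map sending [x] to the vector of
    [closure A] on which [B] agrees with [x] is thus a norm one projection. *)
Lemma projection_of_pair (A : set E) (B : set (dual E)) :
  rational_subspace A -> B `<=` dual_ball E ->
  (forall g, dual_ball E g -> approximates B A g) ->
  (forall x, exists m, closure A m /\ forall b, B b -> b m = b x) ->
  exists P : clin E E, [/\ opnorm P <= 1, forall x, closure A (P x),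
    forall x b, B b -> b (P x) = b x &
    forall m x, closure A m -> (forall b, B b -> b m = b x) -> P x = m].
Proof.
move=> subA Bball BA BE.
have [cA0 cAD] := closure_rational_subspace subA.
have norming m x : closure A m -> (forall b, B b -> b m = b x) -> `|m| <= `|x|.
  move=> Am mx; apply/ler_addgt0Pr => e e0; have e3 : 0 < e / 3 by rewrite divr_gt0.
  have [a Aa ma] := (closure_normP _ _).1 Am _ e3.
  have [f [fb fa]] := hahn_banach_norm a.
  have [|b Bb ba] := BA f fb [:: a] (e / 3) _ e3.
    by move=> x'; rewrite inE => /eqP->.
  have := ba a (mem_head _ _); rewrite fa ltr_norml.
  have /dual_ballP b1 := Bball b Bb.
  have := b1 x; have := b1 (m - a); rewrite linearB /= mx//.
  have := ler_normD (m - a) a; rewrite subrK.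
  move: ma; rewrite !ler_norml; lra.
have uniq m n x : closure A m -> closure A n ->
    (forall b, B b -> b m = b x) -> (forall b, B b -> b n = b x) -> m = n.
  move=> Am An mx nx; apply/eqP; rewrite -subr_eq0 -normr_le0 -[leRHS](@normr0 _ E).
  apply: norming => [|b Bb]; last by rewrite linearB linear0 /= mx// nx// subrr.
  by rewrite -scaleN1r; exact: cAD.
have [p pP] := choice BE.
have lp : linear p.
  move=> a x y; apply: (uniq _ _ (a *: x + y)); first exact: (pP _).1.
  - by rewrite addrC; apply: cAD; exact: (pP _).1.
  - exact: (pP _).2.
  - by move=> b Bb; rewrite !linearP /= !(pP _).2.
have [P PE P1] := contraction_clin lp (fun x => norming _ x (pP x).1 (pP x).2).
exists P; rewrite PE; split=> // [x|x b Bb|m x Am mx].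
- exact: (pP x).1.
- exact: (pP x).2.
- by apply: (uniq _ _ x) => //; [exact: (pP x).1|exact: (pP x).2].
Qed.

End DenseSets.

Section Lefts.
Context {A B : Type}.

Definition lefts (l : seq (A + B)) : seq A :=
  pmap (fun u => if u is inl a then Some a else None) l.

Definition rights (l : seq (A + B)) : seq B :=
  pmap (fun u => if u is inr b then Some b else None) l.

Lemma lefts_map s : lefts (map inl s) = s.
Proof. by elim: s => //= a s ->. Qed.

Lemma rights_map s : rights (map inr s) = s.
Proof. by elim: s => //= a s ->. Qed.

End Lefts.

Lemma seq_in_map {U : Type} {V : eqType} (H : set U) (f : V -> U) (s : seq V) :
  (forall x, x \in s -> H (f x)) -> seq_in H (map f s).
Proof.
elim: s => //= x s IH sH; split; first by apply: sH; exact: mem_head.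
by apply: IH => y ys; apply: sH; rewrite inE ys orbT.
Qed.

Section SokolovToProjectional.
Context {R : realType} {E : normedModType R} (D : set (dual E)).
Hypothesis D_ball : D `<=` dual_ball E.
Hypothesis D_dense : dense (ball_trace D).
Hypothesis D_cc : countably_compact (D : set (wstar E)).
Local Notation T := (sigma D).
Context (r : set (set T) -> T -> T) (N : set (set T) -> set (set T)).
Hypothesis r_ok : forall F, countable_closed_family F ->
  [/\ continuous_retraction (r F), countable (N F),
    external_network (N F) (range (r F)) & forall A, F A -> r F @` A `<=` A].
Hypothesis N_cont : forall F : nat -> set (set T),
  (forall n, countable_closed_family (F n)) -> (forall n, F n `<=` F n.+1) ->
  N (\bigcup_n F n) = \bigcup_n N (F n).

(** A map preserving these half-spaces preserves the values of the functionals
    in [B], by density of the rationals. *)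
Definition half_spaces (B : set (dual E)) : set (set T) :=
  [set C | exists b (q : rat), [/\ B b, D b &
    C = [set x : E | b x <= ratr q] \/ C = [set x : E | ratr q <= b x]]].

Lemma half_spaces_ok B : countable B -> countable_closed_family (half_spaces B).
Proof.
move=> cB; split=> [|C [b [q [Bb Db bq]]]].
  have sub : half_spaces B `<=` \bigcup_(b in B) \bigcup_(q : rat)
      ([set [set x : E | b x <= ratr q]] `|` [set [set x : E | ratr q <= b x]]).
    by move=> C [b [q [Bb _ CE]]]; exists b => //; exists q.
  apply: (sub_countable (subset_card_le sub)).
  apply: bigcup_countable => // b _; apply: bigcup_countable => [|q _]; first exact: countableP.
  by apply: countable_setU; exact: countable1.
have cb : continuous ((fun x : E => b x) : T -> R^o).
  exact: ((@sigma_weak R E D).1 (SigSub (mem_set Db))).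
by case: bq => ->; apply: closed_le_continuous => //; exact: cst_continuous.
Qed.

Lemma half_spaces_bigcup (B : nat -> set (dual E)) :
  half_spaces (\bigcup_n B n) = \bigcup_n half_spaces (B n).
Proof.
apply/seteqP; split=> [C [b [q [[n _ Bb] Db CE]]]|C [n _ [b [q [Bb Db CE]]]]].
  by exists n => //; exists b, q.
by exists b, q; split=> //; exists n.
Qed.

Lemma half_spaces_fixed B b x : countable B -> B b -> D b ->
  b (r (half_spaces B) x : E) = b (x : E).
Proof.
move=> cB Bb Db; have [_ _ _ rF] := r_ok (half_spaces_ok cB).
apply/eqP; rewrite eq_le; apply/andP; split; rewrite leNgt; apply/negP => h.
- have [q] := rat_in_itvoo h; rewrite in_itv /= => /andP[xq qr].
  have : [set x : E | b x <= ratr q] (r (half_spaces B) x : E).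
    by apply: rF; [exists b, q; split=> //; left|exists x => //=; exact: ltW].
  by rewrite /= leNgt qr.
- have [q] := rat_in_itvoo h; rewrite in_itv /= => /andP[rq qx].
  have : [set x : E | ratr q <= b x] (r (half_spaces B) x : E).
    by apply: rF; [exists b, q; split=> //; right|exists x => //=; exact: ltW].
  by rewrite /= leNgt rq.
Qed.

(** A separable closed subspace of [E] is closed for the topology of pointwise
    convergence on [D], because [D] contains the functionals separating it. *)
Lemma sigma_closure_sub (A : set E) (m : E) : countable A -> rational_subspace A ->
  (forall U : set T, open U -> U m -> A `&` U !=set0) -> closure A m.
Proof.
move=> cA subA mA; apply/closure_normP => e e0; apply: contrapT => /forall2NP noA.
have subM := closure_rational_subspace subA.
have far a : closure A a -> e / 2 <= `|m - a|.
  move=> Aa; rewrite leNgt; apply/negP => ma.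
  have e2 : 0 < e / 2 by rewrite divr_gt0.
  have [a' Aa' aa'] := (closure_normP _ _).1 Aa _ e2.
  have [|] := noA a'; first by [].
  move=> []; have := ler_distD a m a'; move: ma aa'; lra.
have [|g [gb gA gm]] := hahn_banach_separation subM _ far; first by rewrite divr_ge0 ?ltW.
have gpos : 0 < g m by apply: lt_le_trans gm; rewrite divr_gt0.
have cA' := countable_setU cA (countable1 m).
have gDA : approximates D (A `|` [set m]) g.
  move=> s e' sA e'0; exact: (dense_approximates D_dense gb (fun _ _ => I) e'0).
have [d [Dd dg _]] := countably_compact_interpolation D_cc cA' (fun _ h => h) gDA.
have cd : continuous ((fun x : E => d x) : T -> R^o).
  exact: ((@sigma_weak R E D).1 (SigSub (mem_set Dd))).
have oU : open ([set x : E | 0 < d x] : set T).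
  have -> : [set x : E | 0 < d x] = ~` [set x : E | d x <= 0].
    by apply/seteqP; split=> x /=; rewrite ltNge => /negP.
  by apply: closed_openC; apply: closed_le_continuous => //; exact: cst_continuous.
have [|a [Aa /=]] := mA _ oU; first by rewrite /= dg//; right.
by rewrite dg ?gA ?ltxx//; [exact: subset_closure|left].
Qed.

Context (hit : seq E -> set (dual E)).
Hypothesis hitP : forall s, [/\ countable (hit s), hit s `<=` D &
  forall d e, D d -> 0 < e -> exists2 b, hit s b &
    forall x, x \in s -> `|b x - d x| < e].

(** Sets closed under this rule provide a rational subspace [A] of [E] and a
    set [B] of functionals dense in [D] for the topology of pointwise
    convergence on [A]; [A] meets every nonempty member of the networks
    assigned to finite subsets of [B]. *)
Definition sokolov_rule (l : seq (E + dual E)) : set (E + dual E) :=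
  [set inl 0] `|`
  (\bigcup_(a in [set` lefts l]) \bigcup_(b in [set` lefts l])
    range (fun q : rat => inl (a + ratr q *: b))) `|`
  inr @` hit (lefts l) `|`
  (fun M : set T => inl (xget (0 : E) M)) @` N (half_spaces [set` rights l]).

Lemma countable_image (V W : Type) (f : V -> W) (S : set V) : countable S -> countable (f @` S).
Proof. exact: (sub_countable (card_image_le _ _)). Qed.

Lemma countable_mem (V : eqType) (s : seq V) : countable [set` s].
Proof. exact: (finite_set_countable (finite_seq s)). Qed.

Lemma sokolov_rule_countable l : countable (sokolov_rule l).
Proof.
apply: countable_setU.
  apply: countable_setU; last by apply: countable_image; have [] := hitP (lefts l).
  apply: countable_setU; first exact: countable1.
  apply: bigcup_countable => [|a _]; first exact: countable_mem.
  apply: bigcup_countable => [|b _]; first exact: countable_mem.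
  exact/countable_image/countableP.
apply: countable_image.
by have [] := r_ok (half_spaces_ok (countable_mem (rights l))).
Qed.

Local Notation G := (skolem_set sokolov_rule).

Definition vectors (H : G) : set E := [set a | (H : set _) (inl a)].
Definition functionals (H : G) : set (dual E) := [set b | (H : set _) (inr b) /\ D b].

Lemma countable_vectors H : countable (vectors H).
Proof.
apply: sub_countable (countable_image (fun u : E + dual E => if u is inl a then a else 0) (skolem_setP H).1).
by apply: subset_card_le => a Ha; exists (inl a).
Qed.

Lemma countable_functionals H : countable (functionals H).
Proof.
apply: sub_countable (countable_image (fun u : E + dual E => if u is inr b then b else 0) (skolem_setP H).1).
by apply: subset_card_le => b [Hb _]; exists (inr b).
Qed.

Lemma vectors_rational_subspace H : rational_subspace (vectors H).
Proof.
have cH := (skolem_setP H).2; split=> [|q x y Hx Hy].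
  by apply: (cH [::]) => //; left; left; left.
apply: (cH [:: inl x; inl y]) => //; left; left; right.
by exists x => /=; rewrite ?inE ?eqxx//; exists y; rewrite /= ?inE ?eqxx ?orbT//; exists q.
Qed.

Lemma functionals_approximate H g : dual_ball E g -> approximates (functionals H) (vectors H) g.
Proof.
move=> gb; apply: (approximates_hitting D_dense) => // s d e sH Dd e0.
have [_ hD /(_ d e Dd e0)[b hb bd]] := hitP s; exists b => //; split; last exact: hD.
apply: ((skolem_setP H).2 (map inl s)); first exact: seq_in_map.
by left; right; rewrite lefts_map; exists b.
Qed.

(** By [omega]-monotonicity each member of the network of a countable family is
    already in the network of the half-spaces of a finite set. *)
Lemma network_meets_vectors H (M : set T) :
  N (half_spaces (functionals H)) M -> M !=set0 -> vectors H `&` M !=set0.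
Proof.
move=> NM M0; suff [s sH NsM] : exists2 s : seq (dual E),
    (forall b, b \in s -> (H : set _) (inr b)) & N (half_spaces [set` s]) M.
  exists (xget 0 M); split; last by have [x Mx] := M0; exact: (xgetPex 0 (ex_intro M x Mx)).
  apply: ((skolem_setP H).2 (map inr s)); first exact: seq_in_map.
  by right; rewrite rights_map; exists M.
have [B0|/set0P/(countable_enum (countable_functionals H))[b bB]] := eqVneq (functionals H) set0.
  exists [::] => //; move: NM; rewrite B0; congr (N (half_spaces _) M).
  by apply/seteqP; split.
pose s n := map b (iota 0 n).
have sB : functionals H = \bigcup_n [set` s n].
  rewrite -bB; apply/seteqP; split=> [_ [n _ <-]|_ [n _ /mapP[i _ ->]]]; last by exists i.
  by exists n.+1 => //=; apply: map_f; rewrite mem_iota /= add0n.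
have incs n : [set` s n] `<=` [set` s n.+1].
  move=> _ /mapP[i + ->] /=; rewrite mem_iota add0n => /= ni; apply: map_f.
  by rewrite mem_iota add0n /= ltnW.
move: NM; rewrite sB half_spaces_bigcup N_cont.
- move=> [n _ NM]; exists (s n) => // c /mapP[i _ ->].
  by have [] : functionals H (b i) by rewrite -bB; exists i.
- by move=> n; exact/half_spaces_ok/countable_mem.
- by move=> n C [c [q [sc Dc CE]]]; exists c, q; split=> //; exact: incs.
Qed.

(** The Sokolov retraction attached to the half-spaces moves [x] into the
    [sigma(E, D)]-closure of the vectors of [H]. *)
Lemma closure_vectors_lift H x : exists m, closure (vectors H) m /\
  forall b, functionals H b -> b m = b x.
Proof.
have cF := countable_functionals H; have [_ _ nw _] := r_ok (half_spaces_ok cF).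
exists (r (half_spaces (functionals H)) x : E); split=> [|b Hb].
  apply: sigma_closure_sub; [exact: countable_vectors|exact: vectors_rational_subspace|].
  move=> U oU Um; have [M [NM Mm MU]] := nw _ U (imageT _ _) oU Um.
  have [|a [Ha Ma]] := network_meets_vectors NM; first by exists (r (half_spaces (functionals H)) x).
  by exists a; split=> //; exact: MU.
by apply: half_spaces_fixed => //; exact: Hb.2.
Qed.

(** The adjoint of [P_H] maps the dual ball into [D]: the functional [f o P_H]
    is interpolated on the vectors of [H] by an element of [D] in the closure
    of the functionals of [H], which vanishes on the kernel of [P_H]. *)
Theorem projectional_of_rule :
  induced_by_one_projectional_skeleton (lin_span D) /\ lin_span D `&` dual_ball E = D.
Proof.
have FD H : functionals H `<=` D by move=> b [].
have /choice[P PP] : forall H : G, exists P : clin E E,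
    [/\ opnorm P <= 1, forall x, closure (vectors H) (P x),
    forall x b, functionals H b -> b (P x) = b x &
    forall m x, closure (vectors H) m -> (forall b, functionals H b -> b m = b x) -> P x = m].
  move=> H; apply: projection_of_pair; first exact: vectors_rational_subspace.
  - exact: subset_trans (FD H) D_ball.
  - exact: functionals_approximate.
  - exact: closure_vectors_lift.
have P_fix H x : closure (vectors H) x -> P H x = x.
  by move=> Hx; have [_ _ _] := PP H; apply.
have P_closure H x : closure (vectors H) (P H x) by have [_ h _ _] := PP H.
have P_functional H x b : functionals H b -> b (P H x) = b x.
  by have [_ _ h _] := PP H; exact: h.
have rangeP H : range (P H) = closure (vectors H).
  by apply/seteqP; split=> [_ [x _ <-]//|x Hx]; exists x => //; exact: P_fix.
have adjD H f : dual_ball E f -> D (adjoint (P H) f).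
  move=> fb; have [P1 _ _ _] := PP H.
  have [d [Dd df dB]] := countably_compact_interpolation D_cc (countable_vectors H) (@FD H)
      (functionals_approximate (H := H) fb).
  suff -> : adjoint (P H) f = d by [].
  apply: clin_ext => x; rewrite adjointE.
  have dP : d (P H x) = d x.
    apply/eqP; rewrite -subr_eq0 -linearB -normr_le0.
    apply/ler_addgt0Pr => e e0; rewrite add0r.
    have [b Hb bd] := dB [:: P H x - x] e (fun _ _ => I) e0.
    have bx : b (P H x - x) = 0 by rewrite linearB /= P_functional// subrr.
    by have := bd _ (mem_head _ _); rewrite bx sub0r normrN; exact: ltW.
  rewrite -dP.
  (* both functionals are continuous and agree on [vectors H] *)
  have : closure (vectors H) `<=` [set y : E | f y = d y].
    have -> : [set y : E | f y = d y] = closure [set y : E | f y = d y].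
      apply/closure_id/closed_eq_continuous; exact: clin_continuous.
    by apply: closure_subset => a Ha /=; rewrite df.
  by apply; exact: P_closure.
have induced : lin_span D = \bigcup_H range (adjoint (P H)).
  apply/seteqP; split=> [f [n [c [a [Da ->]]]]|_ [H _ [f _ <-]]].
    have [H Ha] := skolem_set_exists sokolov_rule_countable
      (countable_image (fun i => inr (a i)) (countableP [set: 'I_n])).
    exists H => //; exists (\sum_(i < n) c i *: a i) => //.
    apply: clin_ext => x; rewrite adjointE !dual_sumE; apply: eq_bigr => i _.
    by rewrite P_functional//; split=> //; apply: Ha; exists i.
  (* rescaled to norm at most one, [f o P_H] lies in [D] *)
  have c0 : 0 < 1 + opnorm f by rewrite ltr_wpDr// opnorm_ge0.
  have fb : dual_ball E ((1 + opnorm f)^-1 *: f).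
    apply/dual_ballP => x; rewrite dualZ normrM gtr0_norm ?invr_gt0//.
    rewrite ler_pdivrMl//; apply: le_trans (ler_opnorm f x) _.
    by rewrite mulrDl mul1r ler_wpDl.
  have -> : adjoint (P H) f = (1 + opnorm f) *: adjoint (P H) ((1 + opnorm f)^-1 *: f).
    apply: clin_ext => x; rewrite dualZ !adjointE dualZ mulrA divff ?mul1r//.
    exact: lt0r_neq0.
  exact/sub_lin_span/adjD.
split; last first.
  apply/seteqP; split=> [f [+ fb]|f Df]; last first.
    by split; [rewrite -[f]scale1r; exact: sub_lin_span|exact: D_ball].
  rewrite induced => -[H _ [g _ gf]]; suff -> : f = adjoint (P H) f by exact: adjD.
  by rewrite -gf; apply: clin_ext => x; rewrite !adjointE (P_fix H (P H x)).
exists (Order.Disp tt tt), G, P; split=> //; split; last by move=> H; have [] := PP H.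
split.
- exact: (skolem_directed sokolov_rule_countable).
- by move=> H; apply/funext => x /=; rewrite P_fix.
- move=> H; exists (vectors H); split; first exact: countable_vectors.
    by rewrite rangeP; exact: subset_closure.
  by rewrite rangeP.
- apply/seteqP; split=> // x _.
  have [H Hx] := skolem_set_exists sokolov_rule_countable (countable1 (inl x)).
  by exists H => //; rewrite rangeP; apply: subset_closure; exact: Hx.
- move=> H K /skolem_leP HK; split; apply/funext => x /=; last first.
    by apply: P_fix; apply: closure_subset (P_closure H x) => a; exact: HK.
  have [_ _ _ uniq] := PP H; apply: uniq => // b Hb.
  by rewrite P_functional// P_functional//; split; [exact: HK Hb.1|exact: Hb.2].
- move=> s incs; have [t [tlub tE]] := skolem_sup incs; exists t; split=> //.
  rewrite rangeP; apply/seteqP; split.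
    apply: closure_subset => a; rewrite /vectors /= tE => -[n _ Ha].
    by exists n => //; rewrite rangeP; exact: subset_closure.
  move=> x Ux; suff : closure (closure (vectors t)) x.
    by rewrite -((closure_id _).1 (@closed_closure _ _)).
  apply: closure_subset Ux => y [n _]; rewrite rangeP; apply: closure_subset => a Ha.
  by rewrite /vectors /= tE; exists n.
Qed.

End SokolovToProjectional.

Theorem projectional_of_sokolov {R : realType} {E : normedModType R}
    (D : set (dual E)) : D `<=` dual_ball E -> dense (ball_trace D) ->
  countably_compact (D : set (wstar E)) -> monotonically_Sokolov (sigma D) ->
  induced_by_one_projectional_skeleton (lin_span D) /\ lin_span D `&` dual_ball E = D.
Proof.
move=> D_ball D_dense D_cc [r [N [r_ok _ N_cont]]].
have [hit hitP] := exists_hitting D.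
exact: (projectional_of_rule D_ball D_dense D_cc r_ok N_cont hitP).
Qed.

(** * Retractional skeletons in the dual ball *)

Lemma metrizable_nbhs {R : realType} (T : topologicalType) : metrizable R T ->
  exists d : T -> T -> R, [/\ forall x, d x x = 0, forall x y, d x y = 0 -> x = y,
    forall x y, d x y = d y x, forall x y z, d x z <= d x y + d y z &
    forall x e, 0 < e -> nbhs x [set y | d x y < e]].
Proof.
move=> [m mE]; pose M : metricType R := Metric.Pack m.
have mnbhs (x : T) (A : set T) : nbhs (x : M) (A : set M) -> nbhs x A.
  rewrite !nbhsE => -[B [oB Bx] BA]; exists B => //; split=> //.
  by rewrite -mE.
exists (fun x y : T => mdist (x : M) (y : M)); split.
- exact: (@mdistxx _ M).
- exact: (@mdist_positivity _ M).
- exact: (@metric_sym _ M).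
- exact: (@metric_triangle _ M).
- move=> x e e0; apply: mnbhs.
  by have := nbhsx_ballx (x : M) e e0; rewrite ballEmdist.
Qed.

Section Skeleton.
Context {R : realType} {E : normedModType R}.
Local Notation X := (wstar_ball E).
Context {d : Order.disp_t} {G : porderType d} (r : G -> X -> X).
Hypothesis r_skel : retractional_skeleton R r.

Let r_cont s : continuous (r s) := (rskel_retraction r_skel s).1.

Lemma skel_idem s f : r s (r s f) = r s f.
Proof. exact: (congr1 (fun h => h f) (rskel_retraction r_skel s).2). Qed.

Lemma skel_absorb s t f : (s <= t)%O -> r s (r t f) = r s f.
Proof. by move=> /(rskel_comp r_skel)[/(congr1 (fun h => h f))]. Qed.

Lemma skel_fix s t f : (s <= t)%O -> r t (r s f) = r s f.
Proof. by move=> /(rskel_comp r_skel)[_ /(congr1 (fun h => h f))]. Qed.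

Lemma ev_retraction_continuous x s : continuous (fun f : X => ev x (r s f) : R^o).
Proof. by move=> f; apply: continuous_comp; [exact: r_cont|exact: ev_continuous]. Qed.

(** Passing to a strictly increasing subsequence, unless the sequence is
    eventually constant. *)
Lemma skel_sequence_sup (s : nat -> G) : (forall n, (s n <= s n.+1)%O) ->
  exists t, (forall n, (s n <= t)%O) /\
    forall f g, (forall n, r (s n) f = r (s n) g) -> r t f = r t g.
Proof.
move=> incs; have mono m n : (m <= n)%N -> (s m <= s n)%O.
  by move=> mn; apply: (homo_leq (@lexx _ G) (@le_trans _ G)) mn.
have [[N Nconst]|/forallNP notconst] := pselect (exists N, forall n, (N <= n)%N -> s n = s N).
  exists (s N); split=> [n|f g fg]; last exact: fg.
  by have [Nn|/ltnW/mono//] := leqP N n; rewrite Nconst.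
have /choice[phi phiP] : forall N, exists n, (N < n)%N /\ (s N < s n)%O.
  move=> N; have /existsNP[n /not_implyP[Nn /eqP nN]] := notconst N.
  exists n; split; last by rewrite lt_neqAle eq_sym nN mono.
  by rewrite ltn_neqAle Nn andbT; apply: contraNneq nN => ->.
pose u k := iter k phi 0%N.
have uge k : (k <= u k)%N by elim: k => //= k IH; apply: leq_ltn_trans IH (phiP _).1.
have [t [[tub _] tlim]] := rskel_sup r_skel (s := s \o u) (fun k => (phiP (u k)).2).
exists t; split=> [n|f g fg].
  by apply: le_trans (mono _ _ (uge n)) _; apply: tub; exists n.
apply: ev_inj => x.
have evlim h : (ev x (r (s (u n)) h) : R^o) @[n --> \oo] --> (ev x (r t h) : R^o).
  exact: (continuous_cvg _ (@ev_continuous R E x (r t h)) (tlim h)).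
have := evlim f; under eq_fun do rewrite fg.
by move=> /norm_cvg_unique; apply; exact: evlim.
Qed.

Lemma skel_upper_bound (s : nat -> G) : exists t, forall n, (s n <= t)%O.
Proof.
have /choice[j jP] : forall p : G * G, exists u, (p.1 <= u)%O /\ (p.2 <= u)%O.
  by move=> p; exact: (rskel_directed r_skel).2.
pose v := fix v n := if n is m.+1 then j (v m, s m) else s 0%N.
have [t [tv _]] := @skel_sequence_sup v (fun n => (jP (v n, s n)).1).
by exists t => n; apply: le_trans (tv n.+1); exact: (jP (v n, s n)).2.
Qed.

(** Otherwise there are [s_0 < s_1 < ...] and functionals whose images under
    [r_(s_n)] and [r_(s_(n+1))] stay apart at [x]. A cluster point of the pairs
    of images consists of two functionals identified by every [r_(s_n)],
    hence equal. *)
Lemma skel_uniformly_cauchy (x : E) (e : R) : 0 < e ->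
  exists s, forall t, (s <= t)%O -> forall f, `|ev x (r t f) - ev x (r s f)| < e.
Proof.
move=> e0; apply: contrapT => /forallNP nos.
have /choice[p pP] : forall s, exists p : G * X, (s <= p.1)%O /\
    e <= `|ev x (r p.1 p.2) - ev x (r s p.2)|.
  move=> s; have /existsNP[t /not_implyP[st /existsNP[f /negP]]] := nos s.
  by rewrite -leNgt => h; exists (t, f).
have [[s0 _] _] := rskel_directed r_skel.
pose s n := iter n (fun s => (p s).1) s0.
have incs n : (s n <= s n.+1)%O by exact: (pP (s n)).1.
have mono m n : (m <= n)%N -> (s m <= s n)%O.
  by move=> mn; apply: (homo_leq (@lexx _ G) (@le_trans _ G)) mn.
have [t [st t_inj]] := skel_sequence_sup incs.
pose y n : X * X := (r (s n.+1) (p (s n)).2, r (s n) (p (s n)).2).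
have cXX : compact [set: X * X] by rewrite -setXTT; apply: compact_setX; exact: banach_alaoglu.
have [q qP] := compact_seq_cluster y cXX.
have c1 (h : X -> R^o) : continuous h -> continuous (fun q : X * X => h q.1 : R^o).
  by move=> ch z; apply: continuous_comp; [exact: cvg_fst|exact: ch].
have c2 (h : X -> R^o) : continuous h -> continuous (fun q : X * X => h q.2 : R^o).
  by move=> ch z; apply: continuous_comp; [exact: cvg_snd|exact: ch].
have q1 : r t q.1 = q.1.
  apply: ev_inj => w; apply: (qP [set q : X * X | ev w (r t q.1) = ev w q.1] 0%N).
    exact: closed_eq_continuous (c1 _ (@ev_retraction_continuous w t)) (c1 _ (@ev_continuous R E w)).
  by move=> n _; exact: congr1 (skel_fix _ (st n.+1)).
have q2 : r t q.2 = q.2.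
  apply: ev_inj => w; apply: (qP [set q : X * X | ev w (r t q.2) = ev w q.2] 0%N).
    exact: closed_eq_continuous (c2 _ (@ev_retraction_continuous w t)) (c2 _ (@ev_continuous R E w)).
  by move=> n _; exact: congr1 (skel_fix _ (st n)).
have q12 : q.1 = q.2.
  rewrite -q1 -q2; apply: t_inj => m; apply: ev_inj => w.
  apply: (qP [set q : X * X | ev w (r (s m) q.1) = ev w (r (s m) q.2)] m).
    exact: closed_eq_continuous (c1 _ (@ev_retraction_continuous w (s m))) (c2 _ (@ev_retraction_continuous w (s m))).
  move=> n mn.
  change (ev w (r (s m) (r (s n.+1) (p (s n)).2)) = ev w (r (s m) (r (s n) (p (s n)).2))).
  by rewrite (skel_absorb _ (mono _ _ (leqW mn))) (skel_absorb _ (mono _ _ mn)).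
have : e <= `|ev x q.1 - ev x q.2|.
  apply: (qP [set q : X * X | e <= `|ev x q.1 - ev x q.2|] 0%N).
    apply: closed_le_continuous; first exact: cst_continuous.
    exact: continuous_abs (continuous_sub (c1 _ (@ev_continuous R E x)) (c2 _ (@ev_continuous R E x))).
  by move=> n _ /=; exact: (pP (s n)).2.
by rewrite q12 subrr normr0 leNgt e0.
Qed.

(** Applied along accuracies tending to zero, the uniform Cauchy condition gives
    an index beyond which [ev x (r t f)] does not depend on [t]; its value is then
    the limit [ev x f] along the whole index set. *)
Lemma skel_factor (x : E) : exists s, forall t, (s <= t)%O -> forall f, ev x (r t f) = ev x f.
Proof.
have /choice[s sP] : forall n : nat, exists s, forall t, (s <= t)%O ->
    forall f, `|ev x (r t f) - ev x (r s f)| < n.+1%:R^-1.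
  by move=> n; apply: skel_uniformly_cauchy; rewrite invr_gt0.
have [t st] := skel_upper_bound s; exists t => u tu f.
have same v : (t <= v)%O -> ev x (r v f) = ev x (r t f).
  move=> tv; apply/eqP; rewrite -subr_eq0 -normr_le0; apply/ler_addgt0Pr => e e0; rewrite add0r.
  have e2 : 0 < e / 2 by rewrite divr_gt0.
  have [n ne] := exists_natSinv_lt e2.
  have := sP n _ (le_trans (st n) tv) f; have := sP n _ (st n) f.
  move: ne; move: (n.+1%:R^-1 : R) => c; rewrite !ltr_norml ler_norml; lra.
rewrite (same u tu); have FG := tail_filter_proper (rskel_directed r_skel).
have lim : (ev x (r v f) : R^o) @[v --> tail_filter G] --> (ev x f : R^o).
  exact: (cvg_comp _ _ (@rskel_lim _ _ _ _ _ r_skel f) (@ev_continuous R E x f)).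
apply: (norm_cvg_unique _ lim).
by apply: cvg_near_cst; exists t => // v /= tv; exact: same.
Qed.

(** By compactness, finitely many vectors separate all pairs of functionals whose
    images under [r_s] are at distance at least [1 / (n + 1)]. *)
Lemma skel_separating (s : G) : exists A : set E, countable A /\
  forall f g, (forall a, A a -> ev a f = ev a g) -> r s f = r s g.
Proof.
have [D [Dxx D_eq D_sym D_tri D_nbhs]] := metrizable_nbhs (rskel_metrizable r_skel s).
pose rho (f : X) : set_type (range (r s)) := SigSub (mem_set (imageT (r s) f)).
have rhoE f : set_val (rho f) = r s f by [].
have crho : continuous rho.
  move=> f U; rewrite nbhsE => -[_ [[W oW <-] Wf] WU].
  apply: (@filterS _ (nbhs f) _ (r s @^-1` W)) => [g Wg|]; first exact: WU.
  exact: (@r_cont s f W (open_nbhs_nbhs (conj oW Wf))).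
have cXX : compact [set: X * X] by rewrite -setXTT; apply: compact_setX; exact: banach_alaoglu.
have /choice[l lP] : forall n : nat, exists l : seq E, forall f g,
    (forall a, a \in l -> ev a f = ev a g) -> D (rho f) (rho g) < n.+1%:R^-1.
  move=> n; apply: contrapT => /forallNP nol.
  pose K := [set q : X * X | n.+1%:R^-1 <= D (rho q.1) (rho q.2)].
  have cK : closed K.
    rewrite -[K]setCK; apply: open_closedC; rewrite openE => q /negP.
    rewrite -ltNge => Dq.
    pose e := (n.+1%:R^-1 - D (rho q.1) (rho q.2)) / 2.
    have e0 : 0 < e by rewrite divr_gt0// subr_gt0.
    have n1 : \forall p \near q, D (rho q.1) (rho p.1) < e.
      by apply: (continuous_comp cvg_fst (crho q.1) (D_nbhs _ _ e0)).
    have n2 : \forall p \near q, D (rho q.2) (rho p.2) < e.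
      by apply: (continuous_comp cvg_snd (crho q.2) (D_nbhs _ _ e0)).
    near=> p => /=; apply/negP; rewrite -ltNge.
    have h1 : D (rho q.1) (rho p.1) < e by near: p.
    have h2 : D (rho q.2) (rho p.2) < e by near: p.
    have := D_tri (rho p.1) (rho q.1) (rho p.2); have := D_tri (rho q.1) (rho q.2) (rho p.2).
    rewrite (D_sym (rho p.1) (rho q.1)); move: h1 h2; rewrite /e.
    move: (n.+1%:R^-1 : R) => c; lra.
  have [||q [Kq Zq]] := compact_fip (Z := fun a : E => [set q : X * X | ev a q.1 = ev a q.2])
      (subclosed_compact cK cXX (fun _ _ => I)).
  - move=> a; apply: closed_eq_continuous => z;
      by apply: continuous_comp; [exact: cvg_fst || exact: cvg_snd|exact: ev_continuous].
  - move=> l; have /existsNP[f /existsNP[g /not_implyP[fg /negP]]] := nol l.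
    by rewrite -leNgt => h; exists (f, g).
  - have q12 : q.1 = q.2 by apply: ev_inj => a; exact: Zq.
    by move: Kq; rewrite /K /= q12 Dxx leNgt invr_gt0 ltr0n.
exists (\bigcup_n [set` l n]); split.
  by apply: bigcup_countable => // n _; exact: countable_mem.
move=> f g fg; rewrite -!rhoE; congr set_val; apply: D_eq.
apply/eqP; rewrite eq_le; apply/andP; split.
  apply: le_add_natSinv => n; rewrite add0r; apply/ltW/lP => a al.
  by apply: fg; exists n.
by have := D_tri (rho f) (rho g) (rho f); rewrite Dxx (D_sym (rho g)); lra.
Unshelve. all: by end_near. Qed.

Lemma skel_range_closed t (Z : set (dual E)) (f : X) :
  (forall g : X, Z (set_val g) -> r t g = g) -> Z `<=` dual_ball E ->
  approximates Z setT (set_val f) -> r t f = f.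
Proof.
move=> Zr Zb Zf; apply: ev_inj => y.
have cS : closed [set h : X | ev y (r t h) = ev y h].
  by apply: closed_eq_continuous; [exact: ev_retraction_continuous|exact: ev_continuous].
apply: cS => U /(@wstar_ball_weak R E).2[l [e [e0 lU]]].
have [b Zb' bf] := Zf l e (fun _ _ => I) e0.
exists (in_ball (Zb _ Zb')); split; first by rewrite /= Zr.
by apply: lU => x xl; exact: bf.
Qed.

(** A countable subset of [D] lies in one compact set [r_t B]. *)
Lemma skel_induced_countably_compact (D : set (dual E)) : D `<=` dual_ball E ->
  ball_trace D = \bigcup_s range (r s) -> countably_compact (D : set (wstar E)).
Proof.
move=> Dball DE U oU DU; apply: contrapT => nofin.
have /choice[p pP] : forall n : nat, exists p : X * G, (forall i, (i <= n)%N -> ~ U i (set_val p.1)) /\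
    r p.2 p.1 = p.1.
  move=> n; apply: contrapT => /forallNP nop; apply: nofin.
  exists [fset i | i in iota 0 n.+1]%fset => [i _|f Df]; first by rewrite inE.
  have [s _ [g _ gf]] : (\bigcup_s range (r s)) (in_ball (Dball _ Df)) by rewrite -DE; exact: Df.
  have /not_andP[|] := nop (in_ball (Dball _ Df), s); last by rewrite /= -gf skel_idem.
  move=> /existsNP[i /not_implyP[ni /contrapT fi]].
  by have ii : i \in iota 0 n.+1 by [rewrite mem_iota]; exists i => //; apply/imfsetP; exists i.
have [t st] := skel_upper_bound (fun n => (p n).2).
have cK : compact (set_val @` range (r t) : set (wstar E)).
  apply: continuous_compact; last exact: (rskel_compact r_skel).
  by apply: continuous_subspaceT => f; exact: (@initial_continuous _ (wstar E)).
have [|l _ lP] := compact_countably_compact cK oU.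
- move=> _ [f [g _ gf] <-]; apply: DU.
  by have : (ball_trace D) f by rewrite DE; exists t => //; exists g.
- pose n := (\max_(i <- enum_fset l) i)%N.
  have [|i /= il Ui] := lP (set_val (p n).1).
    by exists (p n).1 => //; exists (p n).1 => //; rewrite -(pP n).2 skel_fix.
  by apply: ((pP n).1 i) Ui; exact: (leq_bigmax_seq (F := id)).
Qed.

End Skeleton.

(** * Skeleton members that are adjoint to projections *)

(** If [xi] is nearly dominated by the coordinates [phi] on a symmetric
    convex set, it is uniformly close to a combination of them: separate the
    cone generated by the pairs [(phi k, e - xi k)]. *)
Lemma uniform_linear_approximation {R : realType} {T : Type} (K : set T) (n : nat)
    (phi : T -> 'rV[R]_n) (xi : T -> R) (e L : R) :
  K !=set0 -> 0 <= e -> 0 <= L ->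
  (forall k k' t, K k -> K k' -> 0 <= t <= 1 -> exists k'', [/\ K k'',
     phi k'' = t *: phi k + (1 - t) *: phi k' & xi k'' = t * xi k + (1 - t) * xi k']) ->
  (forall k, K k -> exists k', [/\ K k', phi k' = - phi k & xi k' = - xi k]) ->
  (forall k, K k -> xi k <= e + L * \sum_i `|phi k 0 i|) ->
  exists c : 'I_n -> R, forall k, K k -> `|xi k - \sum_i c i * phi k 0 i| <= e.
Proof.
move=> [k0 Kk0] e0 L0 Kconv Ksym dom.
pose N (v : 'rV[R]_n) := L * \sum_i `|v 0 i|.
have Ns : sublinear N.
  split=> [v w|a v a0]; rewrite /N.
    rewrite -mulrDr ler_wpM2l// -big_split /=; apply: ler_sum => i _.
    by rewrite mxE ler_normD.
  rewrite [in RHS]mulrCA [in RHS]mulr_sumr; congr (_ * _); apply: eq_bigr => i _.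
  by rewrite mxE normrM ger0_norm.
pose C : set ('rV[R]_n * R) := [set u | exists a k, [/\ 0 <= a, K k &
  u = (a *: phi k, a * (e - xi k))]].
have [|u [a [k [a0 Kk ->]]]|f [lf fN fC]] := @mazur_orlicz R _ N C Ns.
- split.
  + by exists 0, k0; rewrite scale0r mul0r.
  + move=> _ _ [a [k [a0 Kk ->]]] [b [k' [b0 Kk' ->]]] /=.
    have [ab0|abn0] := eqVneq (a + b) 0.
      have [-> ->] : a = 0 /\ b = 0 by split; lra.
      by exists 0, k0; rewrite !scale0r !mul0r !addr0.
    have abp : 0 < a + b by rewrite lt0r abn0 addr_ge0.
    have [|k'' [Kk'' phiE xiE]] := Kconv k k' (a / (a + b)) Kk Kk'.
      by rewrite divr_ge0 ?(ltW abp)//= ler_pdivrMr// mul1r lerDl.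
    have tE : 1 - a / (a + b) = b / (a + b) by field.
    exists (a + b), k''; split=> //; first exact: ltW.
    rewrite phiE xiE tE scalerDr !scalerA; congr (_, _).
      by congr (_ *: _ + _ *: _); field.
    by field.
  + move=> b _ b0 [a [k [a0 Kk ->]]]; exists (b * a), k; split=> //; first exact: mulr_ge0.
    by rewrite /= scalerA mulrA.
- rewrite /= /N; have := dom k Kk; set S := (X in L * X) => h.
  have -> : \sum_i `|(- (a *: phi k)) 0 i| = a * S.
    by rewrite mulr_sumr; apply: eq_bigr => i _; rewrite !mxE normrN normrM ger0_norm.
  have -> : L * (a * S) + a * (e - xi k) = a * (e + L * S - xi k) by ring.
  by rewrite mulr_ge0// subr_ge0.
have f0 : f 0 = 0 by have := lf 1 0 0; rewrite scale1r addr0 mul1r; lra.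
have fE v : f v = \sum_i f (delta_mx 0 i) * v 0 i.
  rewrite [in LHS](row_sum_delta v).
  elim/big_rec2: _ => [//|i y z _ <-]; by rewrite lf mulrC.
have fle k : K k -> xi k + f (phi k) <= e.
  move=> Kk; have : f (phi k) <= e - xi k; last by lra.
  by apply: (fC (phi k, e - xi k)); exists 1, k; rewrite scale1r mul1r ler01.
exists (fun i => - f (delta_mx 0 i)) => k Kk.
have -> : \sum_i - f (delta_mx 0 i) * phi k 0 i = - f (phi k).
  by rewrite [in RHS]fE -sumrN; apply: eq_bigr => i _; rewrite mulNr.
rewrite opprK; have [k' [Kk' phiN xiN]] := Ksym k Kk.
have fN' : f (- phi k) = - f (phi k).
  by rewrite -scaleN1r -[_ *: _]addr0 lf f0 mulN1r addr0.
have := fle k Kk; have := fle k' Kk'; rewrite phiN xiN fN' ler_norml; lra.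
Qed.

(** Under the hypotheses of this section, satisfied when [t] is the supremum of
    the indices of a set closed under [skeleton_rule], the retraction [r_t] is
    the adjoint of a projection onto the closure of [A]. *)
Section ConvexRange.
Context {R : realType} {E : completeNormedModType R} (D : set (dual E)).
Hypothesis D_ball : D `<=` dual_ball E.
Hypothesis D_cc : countably_compact (D : set (wstar E)).
Local Notation X := (wstar_ball E).
Context {d : Order.disp_t} {G : porderType d} (r : G -> X -> X).
Hypothesis r_skel : retractional_skeleton R r.

Context (A : set E) (B : set (dual E)) (t : G).
Hypothesis A_countable : countable A.
Hypothesis A_subspace : rational_subspace A.
Hypothesis B_D : B `<=` D.
Hypothesis B_sym : symmetric_set B.
Hypothesis B_conv : forall b c (q : rat), B b -> B c -> 0 <= (ratr q : R) <= 1 ->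
  B (ratr q *: b + (1 - ratr q) *: c).
Hypothesis B_approximates : forall g, dual_ball E g -> approximates B A g.
Hypothesis A_invariant : forall a f, A a -> ev a (r t f) = ev a f.
Hypothesis A_separates : forall f g, (forall a, A a -> ev a f = ev a g) -> r t f = r t g.
Hypothesis B_fixed : forall f : X, B (set_val f) -> r t f = f.

Local Notation K := (range (r t)).

Lemma range_fixed f : K f -> r t f = f.
Proof. by move=> [g _ <-]; exact: skel_idem. Qed.

Let B_ball : B `<=` dual_ball E.
Proof. exact: subset_trans D_ball. Qed.

Lemma approximated_fixed f : approximates B setT (set_val f) -> K f.
Proof.
by move=> Bf; exists f => //; exact: (skel_range_closed r_skel B_fixed B_ball Bf).
Qed.

(** [r_t B] is the weak* closure of [B]: the functional in that closure
    interpolating [f] on [A] is fixed by [r_t] and not separated from [f] by [A]. *)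
Lemma fixed_approximated f : K f -> approximates B setT (set_val f).
Proof.
move=> Kf; have [g [Dg gf gB]] := countably_compact_interpolation D_cc A_countable
  B_D (B_approximates (ball_val f)).
have Kg : K (in_ball (D_ball Dg)) by exact: approximated_fixed.
suff -> : f = in_ball (D_ball Dg) by [].
rewrite -(range_fixed Kf) -(range_fixed Kg); apply: A_separates => a Aa.
by rewrite in_ballE gf.
Qed.

(** The set [B] is rationally convex, so its closure is convex. *)
Lemma range_convex f g (l : R) : K f -> K g -> 0 <= l <= 1 ->
  exists2 h, K h & forall x, ev x h = l * ev x f + (1 - l) * ev x g.
Proof.
move=> Kf Kg l01; pose h := in_ball (dual_ball_conv l01 (ball_val f) (ball_val g)).
exists h; last by [].
apply: approximated_fixed => s e _ e0.
pose M : R := 1 + 2 * \sum_(x <- s) `|x|.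
have S0 : 0 <= \sum_(x <- s) `|x| by rewrite sumr_ge0.
have M0 : 0 < M by rewrite /M; lra.
have e2 : 0 < e / 2 by rewrite divr_gt0.
have eM : 0 < e / 4 / M by rewrite !divr_gt0.
have [q [q01 lq]] : exists q : rat, 0 <= (ratr q : R) <= 1 /\ `|l - ratr q| < e / 4 / M.
  have [l0|lp] := leP l 0.
    exists 0; rewrite rmorph0 lexx ler01; split=> //.
    by rewrite (_ : l = 0) ?subrr ?normr0//; apply/eqP; rewrite eq_le l0 (andP l01).1.
  have [q] : exists q : rat, ratr q \in `]Num.max 0 (l - e / 4 / M), l[.
    by apply: rat_in_itvoo; rewrite gt_max lp; move: eM; lra.
  rewrite in_itv /= gt_max => /andP[/andP[q0 ql] lq]; exists q.
  by split; [case/andP: (l01) => ? ?; apply/andP; split; lra|rewrite ltr_norml; lra].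
have [b Bb bf] := fixed_approximated Kf (fun _ _ => I) e2 (s := s).
have [c Bc cg] := fixed_approximated Kg (fun _ _ => I) e2 (s := s).
exists (ratr q *: b + (1 - ratr q) *: c); first exact: B_conv.
move=> x xs; rewrite dualP dualZ.
have -> : set_val h x = l * ev x f + (1 - l) * ev x g by [].
have xM : 2 * `|x| <= M.
  have : `|x| <= \sum_(x <- s) `|x|; last by rewrite /M; lra.
  by rewrite (big_rem x xs)/= lerDl sumr_ge0.
move: (ratr q : R) q01 lq => u q01 lq.
have -> : u * b x + (1 - u) * c x - (l * ev x f + (1 - l) * ev x g) =
   (u * (b x - ev x f) + (1 - u) * (c x - ev x g)) + (u - l) * (ev x f - ev x g) by ring.
have h1 : `|u * (b x - ev x f) + (1 - u) * (c x - ev x g)| <= e / 2.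
  have /andP[u0 u1] := q01; have v0 : 0 <= 1 - u by rewrite subr_ge0.
  apply: le_trans (ler_normD _ _) _; rewrite !normrM (ger0_norm u0) (ger0_norm v0).
  have := bf x xs; have := cg x xs; rewrite -/(ev x f) -/(ev x g).
  move: `|b x - _| `|c x - _| (normr_ge0 (b x - ev x f)) (normr_ge0 (c x - ev x g)) => y z y0 z0 zc yb.
  have : 0 <= u * (e / 2 - y) by rewrite mulr_ge0// subr_ge0 ltW.
  have : 0 <= (1 - u) * (e / 2 - z) by rewrite mulr_ge0// subr_ge0 ltW.
  lra.
have h2 : `|(u - l) * (ev x f - ev x g)| <= e / 4.
  rewrite normrM distrC; apply: le_trans (_ : e / 4 / M * M <= _); last by rewrite divfK ?gt_eqF.
  apply: ler_pM => //; first exact: ltW.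
  apply: le_trans (ler_normB _ _) _; apply: le_trans xM.
  have := ev_le x f; have := ev_le x g; lra.
by apply: le_lt_trans (ler_normD _ _) _; lra.
Qed.

Lemma range_symmetric f : K f -> exists2 h, K h & forall x, ev x h = - ev x f.
Proof.
move=> Kf; pose h := in_ball (dual_ballN (ball_val f)).
have hE x : ev x h = - ev x f.
  have := dualP (-1) (set_val f) 0 x; rewrite scaleN1r addr0 mulN1r.
  by rewrite /ev /= => ->; rewrite addr0.
exists h => //; apply: approximated_fixed => s e _ e0.
have [b Bb bf] := fixed_approximated Kf (fun _ _ => I) e0 (s := s).
exists (- b); first exact: B_sym.
move=> x xs; have -> : (- b : dual E) x = - b x.
  by have := dualP (-1) b 0 x; rewrite scaleN1r addr0 mulN1r => ->; rewrite addr0.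
by rewrite -/(ev x h) hE opprK addrC distrC; exact: bf.
Qed.

Lemma range_zero : exists2 z, K z & forall x, ev x z = 0.
Proof.
have [f0 [f0b _]] := hahn_banach_norm (0 : E).
have Kf : K (r t (in_ball f0b)) by exists (in_ball f0b).
have [g Kg gE] := range_symmetric Kf.
have [|z Kz zE] := range_convex (l := 2^-1) Kf Kg.
  by rewrite invr_ge0 ler0n invf_le1 ?ltr0n// ler1n.
by exists z => // x; rewrite zE gE; field.
Qed.

(** Zero is the only point of [r_t B] that [A] does not separate from zero. *)
Lemma range_vanishing f : K f -> (forall a, A a -> ev a f = 0) -> forall x, ev x f = 0.
Proof.
move=> Kf fA x; have [z Kz z0] := range_zero.
suff -> : f = z by exact: z0.
by rewrite -(range_fixed Kf) -(range_fixed Kz); apply: A_separates => a Aa; rewrite fA ?z0.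
Qed.

Lemma closure_sum n (c : 'I_n -> R) (a : 'I_n -> E) : (forall i, A (a i)) ->
  closure A (\sum_i c i *: a i).
Proof.
move=> Aa; have [M0 MD] := closure_rational_subspace A_subspace.
elim/big_rec: _ => [//|i y _ My]; rewrite addrC.
by apply: MD => //; exact/subset_closure/Aa.
Qed.

(** By compactness, on [r_t B] a vector [x] is small wherever finitely many
    vectors of [A] are, hence it is dominated by them. *)
Lemma range_approximation (x : E) (e : R) : 0 < e ->
  exists2 a, A a & forall f, K f -> `|ev x f - ev a f| <= e.
Proof.
move=> e0; have e2 : 0 < e / 2 by rewrite divr_gt0.
have [a aA] : exists a : nat -> E, range a = A.
  by apply: countable_enum => //; exists 0; exact: A_subspace.1.
have Aa i : A (a i) by rewrite -aA; exists i.
pose Z n := [set f : X | e / 2 <= `|ev x f| /\ forall i, (i <= n)%N -> `|ev (a i) f| <= n.+1%:R^-1].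
have [n nZ] : exists n, forall f, K f -> ~ Z n f.
  apply: contrapT => /forallNP allZ.
  have [||n|f [Kf Zf]] := compact_decreasing (Z := Z) (@rskel_compact _ _ _ _ _ r_skel t).
  - move=> n; have -> : Z n = [set f : X | e / 2 <= `|ev x f|] `&`
        \bigcap_(i in [set i | (i <= n)%N]) [set f : X | `|ev (a i) f| <= n.+1%:R^-1] by [].
    apply: closedI; [|apply: closed_bigI => i _]; apply: closed_le_continuous;
      (exact: cst_continuous || exact: continuous_abs (@ev_continuous R E _)).
  - move=> n f [xf af]; split=> // i ni; apply: le_trans (af i (leqW ni)) _.
    by rewrite lef_pV2 ?posrE ?ltr0n// ler_nat.
  - have /existsNP[f /not_implyP[Kf /contrapT Zf]] := allZ n; by exists f.
  have [xf _] := Zf 0%N; move: xf; rewrite range_vanishing//; last first.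
    move=> a'; rewrite -aA => -[i _ <-]; apply/eqP; rewrite -normr_le0.
    apply: le_add_natSinv => n; rewrite add0r; have [_ /(_ i (leq_maxl i n)) h] := Zf (maxn i n).
    by apply: le_trans h _; rewrite lef_pV2 ?posrE ?ltr0n// ler_nat ltnS leq_maxr.
  by rewrite normr0 leNgt e2.
have [z0 Kz0 _] := range_zero.
have [||||k Kk||c cP] := @uniform_linear_approximation R X K n.+1
    (fun f => \row_(i < n.+1) ev (a i) f) (ev x) (e / 2) (`|x| * n.+1%:R).
- by exists z0.
- exact: ltW.
- by rewrite mulr_ge0.
- move=> f g l Kf Kg l01; have [h Kh hE] := range_convex Kf Kg l01.
  by exists h; split=> //; apply/rowP => i; rewrite !mxE hE.
- have [h Kh hE] := range_symmetric Kk.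
  by exists h; split=> //; apply/rowP => i; rewrite !mxE hE.
- move=> f Kf; have L0 : 0 <= `|x| * n.+1%:R by rewrite mulr_ge0.
  have S0 : 0 <= \sum_(i < n.+1) `|(\row_(i < n.+1) ev (a i) f) 0 i| by rewrite sumr_ge0.
  have LS0 := mulr_ge0 L0 S0.
  have [xf|xf] := ltP `|ev x f| (e / 2).
    by apply: le_trans (ler_norm _) _; apply: le_trans (ltW xf) _; rewrite lerDl.
  have /not_andP[//|/existsNP[i /not_implyP[ni /negP]]] := nZ f Kf; rewrite -ltNge => fi.
  have : `|x| <= `|x| * n.+1%:R * \sum_(i < n.+1) `|(\row_(i < n.+1) ev (a i) f) 0 i|.
    rewrite -mulrA ler_peMr//; rewrite (bigD1 (inord i))//= mxE inordK//.
    rewrite -[leLHS](@mulfV _ (n.+1%:R : R)) ?pnatr_eq0// ler_wpM2l//.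
    by rewrite ler_wpDr ?sumr_ge0// ltW.
  have := le_trans (ler_norm _) (ev_le x f); lra.
have [b Ab bc] := (closure_normP _ _).1 (@closure_sum _ c (fun i => a i) (fun i => Aa i)) _ e2.
exists b => // f Kf; have := cP f Kf.
have -> : \sum_(i < n.+1) c i * (\row_(i < n.+1) ev (a i) f) 0 i = ev (\sum_(i < n.+1) c i *: a i) f.
  by rewrite /ev linear_sum; apply: eq_bigr => i _; rewrite mxE linearZ.
have := ev_le (\sum_(i < n.+1) c i *: a i - b) f; rewrite evB.
move: bc; set v := \sum_(i < n.+1) _; rewrite !ler_norml; lra.
Qed.

(** The approximants of [x] form a Cauchy sequence: the elements of [A] attain
    their norm on [r_t B]. *)
Lemma range_lift (x : E) : exists m, closure A m /\ forall f, ev m f = ev x (r t f).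
Proof.
have /choice[a aP] : forall n : nat, exists a, A a /\ forall f, K f -> `|ev x f - ev a f| <= n.+1%:R^-1.
  by move=> n; have [|a Aa af] := @range_approximation x n.+1%:R^-1; [rewrite invr_gt0|exists a].
have aK n f : `|ev x (r t f) - ev (a n) f| <= n.+1%:R^-1.
  by rewrite -(A_invariant f (aP n).1); apply: (aP n).2; exists f.
have aC n m : `|a n - a m| <= n.+1%:R^-1 + m.+1%:R^-1.
  have [f [fb <-]] := hahn_banach_norm (a n - a m).
  have := aK n (in_ball fb); have := aK m (in_ball fb).
  rewrite -[f _]/(ev _ (in_ball fb)) evB !ler_norml; move: (n.+1%:R^-1 : R) (m.+1%:R^-1 : R) => u v; lra.
have inv_le (N n : nat) : (N <= n)%N -> n.+1%:R^-1 <= N.+1%:R^-1 :> R.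
  by move=> Nn; rewrite lef_pV2 ?posrE ?ltr0n// ler_nat.
have : cvg (a @ \oo).
  apply/cauchy_cvgP/cauchy_ballP => e e0; have e2 : 0 < e / 2 by rewrite divr_gt0.
  have [N Ne] := exists_natSinv_lt e2.
  pose T := [set a n | n in [set n | (N <= n)%N]].
  exists (T, T); first by split; exists N => // n /= Nn; exists n.
  move=> [_ _] [/= [n /= Nn <-] [m /= Nm <-]]; rewrite -ball_normE /=.
  have := aC n m; have := inv_le _ _ Nn; have := inv_le _ _ Nm.
  move: Ne; move: (N.+1%:R^-1 : R) (n.+1%:R^-1 : R) (m.+1%:R^-1 : R) => *; lra.
move=> /cvg_ex[m am]; exists m.
have near_m e : 0 < e -> exists n, `|m - a n| < e /\ n.+1%:R^-1 < e.
  move=> e0; have [N Ne] := exists_natSinv_lt e0.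
  have /cvgrPdist_lt/(_ _ e0)[n _ nP] := am; exists (maxn n N); split.
    by apply: nP; exact: leq_maxl.
  by apply: le_lt_trans Ne; apply: inv_le; exact: leq_maxr.
split=> [|f].
  apply/closure_normP => e /near_m[n [mn _]]; exists (a n) => //; exact: (aP n).1.
apply/eqP; rewrite -subr_eq0 -normr_le0; apply/ler_addgt0Pr => e e0; rewrite add0r.
have e2 : 0 < e / 2 by rewrite divr_gt0.
have [n [mn ne]] := near_m _ e2.
have := aK n f; have := ev_le (m - a n) f; rewrite evB.
move: mn ne; move: (n.+1%:R^-1 : R) => c; rewrite !ler_norml; lra.
Qed.

End ConvexRange.

(** * From retractions to the Sokolov property *)

(** The objects handled by the rule: vectors, functionals, indices of the
    skeleton, and closed sets to be preserved. *)
Inductive skolem_obj (V W I J : Type) :=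
  | Vec of V | Fun of W | Idx of I | Clo of J.
Arguments Vec {V W I J}.
Arguments Fun {V W I J}.
Arguments Idx {V W I J}.
Arguments Clo {V W I J}.

Definition vecs {V W I J : Type} (l : seq (skolem_obj V W I J)) : seq V :=
  pmap (fun u => if u is Vec a then Some a else None) l.

Lemma vecs_map {V W I J : Type} (s : seq V) : vecs (map (@Vec V W I J) s) = s.
Proof. by elim: s => //= a s ->. Qed.

(** The box neighbourhood of radius [e] given by the functionals and values
    in [t] misses [C]. *)
Definition misses {R : realType} {E : normedModType R} (C : set E) (e : R)
    (k : nat) (t : 'I_k -> dual E * R) :=
  forall z, C z -> exists i, e <= `|(t i).1 z - (t i).2|.

(** Countably many systems [t'] suffice to imitate all systems [t] missing [C]
    as far as their values at a single vector are concerned. *)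
Lemma exists_reflecting {R : realType} {E : normedModType R} (D : set (dual E)) :
  exists refl : set E * E -> set (dual E), forall p,
    countable (refl p) /\
    forall k (m : nat) (t : 'I_k -> dual E * R) (e : R), (forall i, D (t i).1) ->
      misses p.1 m.+1%:R^-1 t -> 0 < e ->
      exists t' : 'I_k -> dual E * R, [/\ forall i, refl p (t' i).1 /\ D (t' i).1,
        misses p.1 m.+1%:R^-1 t' &
        forall i, `|(t i).1 p.2 - (t' i).1 p.2| < e /\ `|(t i).2 - (t' i).2| < e].
Proof.
suff /choice[refl reflP] : forall p : set E * E, exists S : set (dual E),
    countable S /\
    forall k (m : nat) (t : 'I_k -> dual E * R) (e : R), (forall i, D (t i).1) ->
      misses p.1 m.+1%:R^-1 t -> 0 < e ->
      exists t' : 'I_k -> dual E * R, [/\ forall i, S (t' i).1 /\ D (t' i).1,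
        misses p.1 m.+1%:R^-1 t' &
        forall i, `|(t i).1 p.2 - (t' i).1 p.2| < e /\ `|(t i).2 - (t' i).2| < e].
  by exists refl.
move=> [C a] /=.
pose phi k (t : 'I_k -> dual E * R) (j : 'I_k * bool) : R :=
  if j.2 then (t j.1).1 a else (t j.1).2.
pose admissible k m : set ('I_k -> dual E * R) :=
  [set t | (forall i, D (t i).1) /\ misses C m.+1%:R^-1 t].
have sel k m := cid (countable_selection (@phi k) (admissible k m)).
pose T k m := projT1 (sel k m); have TP k m := projT2 (sel k m).
exists (\bigcup_k \bigcup_m \bigcup_(t in T k m) range (fun i => (t i).1)); split.
  apply: bigcup_countable => // k _; apply: bigcup_countable => // m _.
  apply: bigcup_countable => [|t _]; first by have [] := TP k m.
  exact/countable_image/countableP.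
move=> k m t e tD tC e0; have [_ Tsub Tdense] := TP k m.
have [t' Tt' tt'] := Tdense t (conj tD tC) e e0; have [t'D t'C] := Tsub t' Tt'.
exists t'; split=> // i; last by split; [exact: (tt' (i, true))|exact: (tt' (i, false))].
by split; [exists k => //; exists m => //; exists t' => //; exists i|exact: t'D].
Qed.

Section SkeletonToSokolov.
Context {R : realType} {E : completeNormedModType R} (D : set (dual E)).
Hypothesis D_dense : dense (ball_trace D).
Hypothesis D_ball : D `<=` dual_ball E.
Hypothesis D_cc : countably_compact (D : set (wstar E)).
Hypothesis D_sym : symmetric_set D.
Hypothesis D_conv : @convex_set R (dual E) D.
Local Notation X := (wstar_ball E).
Context {d : Order.disp_t} {G : porderType d} (r : G -> X -> X).
Hypothesis r_skel : retractional_skeleton R r.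
Hypothesis D_induced : ball_trace D = \bigcup_s range (r s).

Context (hit : seq E -> set (dual E)) (tau : E -> G) (sep : G -> set E)
  (join : G * G -> G) (idx : dual E -> G) (refl : set E * E -> set (dual E)).
Hypothesis hitP : forall s, [/\ countable (hit s), hit s `<=` D &
  forall d e, D d -> 0 < e -> exists2 b, hit s b &
    forall x, x \in s -> `|b x - d x| < e].
Hypothesis tauP : forall x t, (tau x <= t)%O -> forall f, ev x (r t f) = ev x f.
Hypothesis sepP : forall s, countable (sep s) /\
  forall f g, (forall a, sep s a -> ev a f = ev a g) -> r s f = r s g.
Hypothesis joinP : forall p, (p.1 <= join p)%O /\ (p.2 <= join p)%O.
Hypothesis idxP : forall f : X, D (set_val f) -> r (idx (set_val f)) f = f.
Hypothesis reflP : forall p, countable (refl p) /\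
  forall k (m : nat) (t : 'I_k -> dual E * R) (e : R), (forall i, D (t i).1) ->
    misses p.1 m.+1%:R^-1 t -> 0 < e ->
    exists t' : 'I_k -> dual E * R, [/\ forall i, refl p (t' i).1 /\ D (t' i).1,
      misses p.1 m.+1%:R^-1 t' &
      forall i, `|(t i).1 p.2 - (t' i).1 p.2| < e /\ `|(t i).2 - (t' i).2| < e].

Local Notation obj := (skolem_obj E (dual E) G (set E)).

(** Vectors call for an index beyond which they are invariant, functionals for
    an index fixing them, and indices for vectors determining the retraction;
    reflection concerns a closed set and one vector, because the value of the
    projection is approximated by a single vector. *)
Definition skeleton_rule (l : seq obj) : set obj :=
  match l with
  | [::] => [set Vec 0]
  | [:: Vec a] => [set Idx (tau a)]
  | [:: Vec a; Vec b] => range (fun q : rat => Vec (a + ratr q *: b))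
  | [:: Fun b] => [set Fun (- b)] `|` [set Idx (idx b)]
  | [:: Fun b; Fun c] => (fun q : rat => Fun (ratr q *: b + (1 - ratr q) *: c)) @`
      [set q : rat | 0 <= (ratr q : R) <= 1]
  | [:: Idx s] => Vec @` sep s
  | [:: Idx s; Idx t] => [set Idx (join (s, t))]
  | [:: Clo C; Vec a] => Fun @` refl (C, a)
  | _ => set0
  end `|` Fun @` hit (vecs l).

Lemma skeleton_rule_countable l : countable (skeleton_rule l).
Proof.
have chit s : countable (@Fun E (dual E) G (set E) @` hit s).
  by apply: countable_image; have [] := hitP s.
apply: countable_setU => //.
case: l => [|[a|b|s|C] [|[a'|b'|s'|C'] [|u l]]];
  rewrite ?set0U; try exact: countable0; try exact: countable1.
- exact/countable_image/countableP.
- by apply: countable_setU; exact: countable1.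
- exact/countable_image/countableP.
- by apply: countable_image; have [] := sepP s.
- by apply: countable_image; have [] := reflP (C, a').
Qed.

Section ClosedSet.
Context (H : set obj).
Hypothesis H_countable : countable H.
Hypothesis H_closed : closed_under skeleton_rule H.

Let A : set E := [set a | H (Vec a)].
Let B : set (dual E) := [set b | H (Fun b) /\ D b].
Let S : set G := [set s | H (Idx s)].

Let A_countable : countable A.
Proof.
apply: sub_countable (countable_image (fun u : obj => if u is Vec a then a else 0) H_countable).
by apply: subset_card_le => a Ha; exists (Vec a).
Qed.

Let S_countable : countable S.
Proof.
apply: sub_countable (countable_image (fun u : obj => if u is Idx s then s else tau 0) H_countable).
by apply: subset_card_le => s Hs; exists (Idx s).
Qed.

Let A0 : A 0. Proof. by apply: (H_closed (l := [::])) => //; left. Qed.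

Let A_subspace : rational_subspace A.
Proof.
split=> // q x y Hx Hy; apply: (H_closed (l := [:: Vec x; Vec y])) => //.
by left; exists q.
Qed.

Let S_tau a : A a -> S (tau a).
Proof. by move=> Ha; apply: (H_closed (l := [:: Vec a])) => //; left. Qed.

Let S_idx b : B b -> S (idx b).
Proof. by move=> [Hb _]; apply: (H_closed (l := [:: Fun b])) => //; left; right. Qed.

Let S_join s t : S s -> S t -> S (join (s, t)).
Proof. by move=> Hs Ht; apply: (H_closed (l := [:: Idx s; Idx t])) => //; left. Qed.

Let A_sep s : S s -> sep s `<=` A.
Proof. by move=> Hs a sa; apply: (H_closed (l := [:: Idx s])) => //; left; exists a. Qed.

Let B_sym : symmetric_set B.
Proof.
move=> b [Hb Db]; split; last exact: D_sym.
by apply: (H_closed (l := [:: Fun b])) => //; left; left.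
Qed.

Let B_conv b c (q : rat) : B b -> B c -> 0 <= (ratr q : R) <= 1 ->
  B (ratr q *: b + (1 - ratr q) *: c).
Proof.
move=> [Hb Db] [Hc Dc] q01; split.
  by apply: (H_closed (l := [:: Fun b; Fun c])) => //; left; exists q.
have /andP[q0 q1] := q01.
have := @D_conv b c (Itv01 q0 q1); rewrite !inE; exact.
Qed.

Let B_approximates g : dual_ball E g -> approximates B A g.
Proof.
move=> gb; apply: (approximates_hitting D_dense) => // s b e sH Db e0.
have [_ hD /(_ b e Db e0)[c hc cb]] := hitP s; exists c => //; split; last exact: hD.
apply: (H_closed (l := map Vec s)); first exact: seq_in_map.
by right; rewrite vecs_map; exists c.
Qed.

Lemma closed_set_sup : exists t, (forall s, S s -> (s <= t)%O) /\
  forall f g, (forall s, S s -> r s f = r s g) -> r t f = r t g.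
Proof.
have [s sS] : exists s : nat -> G, range s = S.
  by apply: countable_enum => //; exists (tau 0); exact: S_tau.
have Ss n : S (s n) by rewrite -sS; exists n.
pose v := fix v n := if n is m.+1 then join (v m, s m) else s 0%N.
have Sv n : S (v n) by elim: n => //= n IH; exact: S_join.
have [t [vt tv]] := skel_sequence_sup r_skel (s := v) (fun n => (joinP (v n, s n)).1).
exists t; split=> [u|f g fg]; last by apply: tv => n; exact/fg/Sv.
rewrite -sS => -[n _ <-]; apply: le_trans (vt n.+1); exact: (joinP (v n, s n)).2.
Qed.

(** [P] is the projection whose adjoint extends [r_t]. If [x] were in [C] but
    [P x] outside it, a system of conditions satisfied by [P x] would miss [C];
    its reflection in [B] is satisfied by [P x], hence by [x], as functionals in
    [B] do not distinguish [P x] from [x]. *)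
Lemma closed_set_retraction : exists P : E -> E,
  [/\ forall x, closure A (P x), forall x, P (P x) = P x,
    forall f : X, D (set_val f) -> exists2 g : X, D (set_val g) &
      forall x, ev (P x) f = ev x g &
    forall C : set E, H (Clo C) -> closed (C : set (sigma D)) -> forall x, C x -> C (P x)].
Proof.
have [t [St t_inj]] := closed_set_sup.
have B_fixed f : B (set_val f) -> r t f = f.
  move=> Bf; rewrite -(idxP Bf.2); apply: skel_fix => //; exact/St/S_idx.
have A_inv a f : A a -> ev a (r t f) = ev a f.
  by move=> Aa; apply: tauP; exact/St/S_tau.
have A_separates f g : (forall a, A a -> ev a f = ev a g) -> r t f = r t g.
  move=> fg; apply: t_inj => s Ss; apply: (sepP s).2 => a sa; apply: fg; exact: A_sep sa.
have BD : B `<=` D by move=> b [].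
have /choice[P PP] : forall x, exists m, closure A m /\ forall f, ev m f = ev x (r t f).
  by move=> x; apply: (range_lift D_ball D_cc r_skel (B := B)).
exists P; split=> [x|x|f Df|C HC cC x Cx].
- exact: (PP x).1.
- have [f [fb fE]] := hahn_banach_norm (P (P x) - P x).
  apply/eqP; rewrite -subr_eq0 -normr_eq0 -fE -[f _]/(ev _ (in_ball fb)) evB.
  by rewrite !(PP _).2 skel_idem// subrr.
- exists (r t f); last by move=> x; exact: (PP x).2.
  have : ball_trace D (r t f) by rewrite D_induced; exists t => //; exists f.
  by [].
- apply: contrapT => nCP.
  have nP : nbhs (P x : sigma D) (~` C : set (sigma D)).
    by apply: open_nbhs_nbhs; split=> //; exact: closed_openC.
  have [s [e [e0 sC]]] := (@sigma_weak R E D).2 _ _ nP.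
  have [m me] := exists_natSinv_lt e0.
  pose u (i : 'I_(size s)) : dual E * R :=
    (set_val (tnth (in_tuple s) i), (set_val (tnth (in_tuple s) i) : dual E) (P x)).
  have uD i : D (u i).1 by exact: set_mem (valP (tnth (in_tuple s) i)).
  have um : misses C m.+1%:R^-1 u.
    move=> z Cz; apply: contrapT => /forallNP far; apply: (sC z) Cz => g gs.
    have [i ->] : exists i, g = tnth (in_tuple s) i by exact/tnthP.
    by have /negP := far i; rewrite -ltNge => /lt_trans; apply.
  have n0 : 0 < m.+1%:R^-1 / 4 :> R by rewrite divr_gt0// invr_gt0.
  have [a Aa xa] := (closure_normP _ _).1 (PP x).1 _ n0.
  have [u' [u'D u'm u'u]] := (reflP (C, a)).2 _ _ _ _ uD um n0.
  have [i] := u'm x Cx; apply/negP; rewrite -ltNge.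
  have Bu' : B (u' i).1.
    split; last exact: (u'D i).2.
    apply: (H_closed (l := [:: Clo C; Vec a])) => //.
    by left; exists (u' i).1 => //; exact: (u'D i).1.
  have b1 := D_ball (u'D i).2; have b2 := D_ball (uD i).
  have -> : (u' i).1 x = (u' i).1 (P x).
    by rewrite -[LHS]/(ev x (in_ball b1)) -[RHS]/(ev (P x) (in_ball b1)) (PP x).2 B_fixed.
  have h1 : `|(u i).1 a - (u' i).1 a| < m.+1%:R^-1 / 4 := (u'u i).1.
  have h2 : `|(u i).1 (P x) - (u' i).2| < m.+1%:R^-1 / 4 := (u'u i).2.
  have h3 := ev_le (P x - a) (in_ball b1); have h4 := ev_le (P x - a) (in_ball b2).
  move: h1 h2 h3 h4 xa n0; rewrite !evB !in_ballE.
  move: (m.+1%:R^-1 : R) => c; rewrite !ltr_norml !ler_norml; lra.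
Qed.

End ClosedSet.

(** The family [F] generates a hull whose projection preserves the members of
    [F], and whose vectors are the centres of the balls of the network. *)
Lemma sokolov_of_skeleton_rule : monotonically_Sokolov (sigma D).
Proof.
pose base (F : set (set E)) : set obj := Clo @` F.
pose Hull (F : set (set E)) := hull skeleton_rule (base F).
have cHull F : countable F -> countable (Hull F).
  by move=> cF; apply: (countable_hull skeleton_rule_countable); exact: countable_image.
have clHull F : closed_under skeleton_rule (Hull F) by exact: hull_closed.
have /choice[P PP] : forall F : set (set E), exists P : E -> E, countable F ->
  [/\ forall x, closure [set a | Hull F (Vec a)] (P x), forall x, P (P x) = P x,
    forall f : X, D (set_val f) -> exists2 g : X, D (set_val g) &
      forall x, ev (P x) f = ev x g &
    forall C : set E, F C -> closed (C : set (sigma D)) -> forall x, C x -> C (P x)].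
  move=> F; have [cF|ncF] := pselect (countable F); last by exists id.
  have [P [P1 P2 P3 P4]] := closed_set_retraction (cHull F cF) (clHull F).
  exists P => _; split=> // C FC; apply: P4; apply: sub_hull; by exists C.
pose N (F : set (set E)) : set (set E) := [set M | exists a (n : nat),
   Hull F (Vec a) /\ M = [set y | `|a - y| < n.+1%:R^-1]].
exists P, N; split.
- move=> F [cF clF]; have [P1 P2 P3 P4] := PP F cF; split.
  + split; last by apply/funext => x; exact: P2.
    apply: (weak_topology_continuous (@sigma_weak R E D)) => -[f Df].
    have Df' := set_mem Df; have fb := D_ball Df'.
    have [g Dg gE] := P3 (in_ball fb) Df'.
    have gc := (@sigma_weak R E D).1 (SigSub (mem_set Dg)).
    have fg : (fun x : E => (f : dual E) (P F x) : R^o) = (fun x : E => (set_val g : dual E) x : R^o).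
      by apply/funext => x; exact: gE.
    suff : continuous ((fun x : E => (f : dual E) (P F x) : R^o) : sigma D -> R^o) by [].
    by rewrite fg.
  + pose bal (p : obj * nat) : set E :=
      [set y | `|(if p.1 is Vec a then a else 0) - y| < p.2.+1%:R^-1].
    have sub : N F `<=` [set bal p | p in Hull F `*` setT].
      by move=> M [a [n [Ha ->]]]; exists (Vec a, n).
    apply: sub_countable (subset_card_le sub) (countable_image _ _).
    by apply: countableX => //; exact: cHull.
  + move=> _ U [x _ <-] oU Ux.
    have [s [e [e0 sU]]] := (@sigma_weak R E D).2 _ _ (open_nbhs_nbhs (conj oU Ux)).
    have e2 : 0 < e / 2 by rewrite divr_gt0.
    have [n ne] := exists_natSinv_lt e2.
    have n0 : 0 < n.+1%:R^-1 :> R by rewrite invr_gt0.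
    have [a Ha xa] := (closure_normP _ _).1 (P1 x) _ n0.
    exists [set y | `|a - y| < n.+1%:R^-1]; split; first by exists a, n.
      by rewrite /= distrC.
    move=> y /= ay; apply: sU => g _.
    have gb := D_ball (set_mem (valP g)).
    have := ev_le (y - P F x) (in_ball gb); rewrite evB !in_ballE => h.
    apply: le_lt_trans h _.
    have := ler_distD a y (P F x); rewrite (distrC y a) (distrC a (P F x)).
    move: ne xa ay; move: (n.+1%:R^-1 : R) => c; lra.
  + by move=> C FC _ [x Cx <-]; exact: P4 (clF _ FC) _ Cx.
- move=> F F' _ _ FF' M [a [n [Ha ->]]]; exists a, n; split=> //.
  by apply: hull_subset Ha; exact: image_subset.
- move=> F _ incF; have HullE : Hull (\bigcup_n F n) = \bigcup_n Hull (F n).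
    rewrite /Hull -hull_bigcup; last by move=> n; exact: image_subset.
    by rewrite /base image_bigcup.
  apply/seteqP; split=> [M [a [n []]]|M [k _ [a [n [Ha ->]]]]].
    by rewrite HullE => -[k _ Ha] ->; exists k => //; exists a, n.
  by exists a, n; split=> //; rewrite HullE; exists k.
Qed.

End SkeletonToSokolov.

Theorem sokolov_of_retractional {R : realType} {E : completeNormedModType R}
    (D : set (dual E)) : D `<=` dual_ball E -> dense (ball_trace D) ->
  @convex_set R (dual E) D -> symmetric_set D ->
  induced_by_retractional_skeleton R (ball_trace D) ->
  countably_compact (D : set (wstar E)) /\ monotonically_Sokolov (sigma D).
Proof.
move=> D_ball D_dense D_conv D_sym [d [G [r [r_skel D_induced]]]].
have D_cc := skel_induced_countably_compact r_skel D_ball D_induced; split=> //.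
have [hit hitP] := exists_hitting D.
have [refl reflP] := exists_reflecting D.
have [tau tauP] := choice (skel_factor r_skel).
have [sep sepP] := choice (skel_separating r_skel).
have /choice[join joinP] : forall p : G * G, exists u, (p.1 <= u)%O /\ (p.2 <= u)%O.
  by move=> p; exact: (rskel_directed r_skel).2.
have /choice[idx idxP] : forall b : dual E, exists s, forall f : wstar_ball E,
    set_val f = b -> D b -> r s f = f.
  move=> b; have [Db|nDb] := pselect (D b); last by have [[s _] _] := rskel_directed r_skel; exists s.
  have [s _ [g _ gb]] : (\bigcup_s range (r s)) (in_ball (D_ball _ Db)) by rewrite -D_induced.
  exists s => f fb _; suff -> : f = in_ball (D_ball _ Db) by rewrite -gb (skel_idem r_skel).
  by apply: val_inj; rewrite -set_valE fb.
exact: (sokolov_of_skeleton_rule D_dense D_ball D_cc D_sym D_conv r_skel D_induced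
  hitP tauP sepP joinP (fun f => idxP _ f erefl) reflP).
Qed.

Theorem theorem5p1 (R : realType) (E : completeNormedModType R)
    (D : set (dual E)) (D_ball : D `<=` dual_ball E)
    (D_dense : dense (ball_trace D)) :
  [<-> induced_by_one_projectional_skeleton (lin_span D) /\
         lin_span D `&` dual_ball E = D;
       [/\ @convex_set R (dual E) D, symmetric_set D &
         induced_by_retractional_skeleton R (ball_trace D)];
       countably_compact (D : set (wstar E)) /\
         monotonically_Sokolov (sigma D)].
Proof.
tfae.
- by case; exact: retractional_of_projectional.
- by case; exact: sokolov_of_retractional.
- by case; exact: projectional_of_sokolov.
Qed.
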